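(* Let $\delta$ be a real number with $\frac{5}{6}<\delta<1$, and let $r=r(n)$ be nonnegative integers with $r=o(n)$. If $n$ is sufficiently large, then for every graph $G$ with $n$ vertices and minimum degree $\delta(G)\geq \delta n$ we have $$\chi(\mathcal{T}_{G,n-r})=\mathrm{cut}_{r+1}(G).$$
   Context: Graphs are finite and simple; $\chi$ denotes the chromatic number and $\delta(G)$ the minimum degree of $G$. The quantity $r$ may depend on $n$; $r=o(n)$ means $r(n)/n\to 0$ as $n\to\infty$, and ''$n$ sufficiently large'' means that there is a threshold $N$, depending on $\delta$ and on $r$, such that the conclusion holds for every $n\ge N$ and every such $G$ on $n$ vertices. For a graph $G$ and an integer $1\le t\le |V(G)|$, the tree graph $\mathcal{T}_{G,t}$ is the graph whose vertices are all subgraphs of $G$ that are trees with exactly $t$ vertices, two of them being adjacent if they are edge-disjoint. A partition $(X,Y)$ of $V(G)$ into two parts is a cut of $G$; its size is the number of edges of $G$ with one end in $X$ and the other in $Y$. A cut $(X,Y)$ is an $s$-cut if $\min\{|X|,|Y|\}\ge s$. The $s$-th cut number $\mathrm{cut}_s(G)$ is the minimum size of an $s$-cut of $G$. *)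

(* Defs.v *)
From mathcomp Require Import all_boot.
From mathcomp Require Import boolp.

Set Implicit Arguments.
Unset Strict Implicit.
Unset Printing Implicit Defensive.

Record sgraph := SGraph {
  vert :> finType;
  adj : rel vert;
  adj_sym : symmetric adj;
  adj_irrefl : irreflexive adj }.

Arguments adj {s}.

Definition edges (G : sgraph) : {set {set G}} :=
  [set e | [exists x, exists y, adj x y && (e == [set x; y])]].

Definition degree (G : sgraph) (x : G) : nat := #|[set y | adj x y]|.

(* Degrees are smaller than #|G|, so the default value of the iterated minimum
   is harmless when G has at least one vertex. *)
Definition min_degree (G : sgraph) : nat :=
  \big[minn/#|G|]_(x : G) degree x.

Definition colorable (G : sgraph) (k : nat) : bool :=
  [exists f : {ffun G -> 'I_k}, forall x, forall y, adj x y ==> (f x != f y)].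

Lemma colorable_ex (G : sgraph) : exists k, colorable G k.
Proof.
exists #|G|; apply/existsP; exists [ffun x => enum_rank x].
apply/forallP => x; apply/forallP => y; apply/implyP => xy; rewrite !ffunE.
by apply: contraTneq xy => /enum_rank_inj ->; rewrite adj_irrefl.
Qed.

Definition chromatic_number (G : sgraph) : nat := ex_minn (colorable_ex G).

Definition connected (G : sgraph) : Prop := forall x y : G, connect adj x y.

(* ucycle also accepts the empty sequence and, by symmetry of adj, the two ends
   of any edge; the graph-theoretic cycles are those of size at least 3. *)
Definition acyclic (G : sgraph) : Prop :=
  forall c : seq G, ucycle adj c -> size c < 3.

Definition is_tree (G : sgraph) : Prop :=
  [/\ 0 < #|G|, connected G & acyclic G].

Section Subgraphs.
Variable G : sgraph.

(* A pair (V, E) of a vertex set and an edge set. *)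
Definition presubgraph := ({set G} * {set {set G}})%type.

Implicit Type H : presubgraph.

Definition is_subgraph H : Prop :=
  H.2 \subset edges G /\ forall e, e \in H.2 -> e \subset H.1.

Section Graph_of.
Variable H : presubgraph.

(* When H is a subgraph of G the condition x != y follows from the second
   one. *)
Definition sub_adj : rel {x : G | x \in H.1} :=
  fun x y => (x != y) && ([set val x; val y] \in H.2).

Lemma sub_adj_sym : symmetric sub_adj.
Proof. by move=> x y; rewrite /sub_adj eq_sym setUC. Qed.

Lemma sub_adj_irrefl : irreflexive sub_adj.
Proof. by move=> x; rewrite /sub_adj eqxx. Qed.

Definition graph_of : sgraph := SGraph sub_adj_sym sub_adj_irrefl.

End Graph_of.

Definition is_subtree (t : nat) H : Prop :=
  [/\ is_subgraph H, is_tree (graph_of H) & #|H.1| = t].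

Definition subtree (t : nat) : finType :=
  {H : presubgraph | `[< is_subtree t H >]}.

Section Tree_graph.
Variable t : nat.

(* Distinctness only matters for t = 1, where a tree has no edges. *)
Definition tree_adj : rel (subtree t) :=
  fun S T => (S != T) && [disjoint (val S).2 & (val T).2].

Lemma tree_adj_sym : symmetric tree_adj.
Proof. by move=> x y; rewrite /tree_adj eq_sym disjoint_sym. Qed.

Lemma tree_adj_irrefl : irreflexive tree_adj.
Proof. by move=> x; rewrite /tree_adj eqxx. Qed.

Definition tree_graph : sgraph := SGraph tree_adj_sym tree_adj_irrefl.

End Tree_graph.

End Subgraphs.

Section Cuts.
Variable G : sgraph.

(* A cut (X, Y) is represented by X, with Y = ~: X. *)
Definition is_cut (X : {set G}) : bool := (X != set0) && (~: X != set0).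

Definition cut_size (X : {set G}) : nat :=
  #|[set e in edges G | [exists x in X, exists y in ~: X, e == [set x; y]]]|.

Definition is_scut (s : nat) (X : {set G}) : bool :=
  is_cut X && (s <= minn #|X| #|~: X|).

(* No cut has more than #|edges G| edges, so this is the minimum over all
   s-cuts as soon as there is one, i.e. when 2 <= #|G| and 2 * s <= #|G|. *)
Definition cut_number (s : nat) : nat :=
  \big[minn/#|edges G|]_(X : {set G} | is_scut s X) cut_size X.

End Cuts.

(* Main.v *)
Require Import Defs.
From mathcomp Require Import all_boot zify ring.
From mathcomp Require Import boolp.

(** Write [n] for the number of vertices and [c] for the [r + 1]-st cut number.

    Upper bound. A tree on [n - r] vertices meets both sides of a cut whose sides have
    more than [r] vertices, so it contains an edge of the cut. Colouring each tree by such
    an edge of a minimum cut is proper ([chromatic_le_cut_number]).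

    Lower bound. The tree graph is a Kneser graph on the edges of [G]. By Ky Fan's
    combinatorial lemma ([fan_label_bound]), its chromatic number is at least the number
    of edges minus the largest number of alternations, along a fixed ordering of the
    edges, of a signing of edges without a monochromatic tree
    ([kneser_alternation_bound]). So an ordering is needed for which every signing with
    deficit less than [c] has a component with at least [n - r] vertices in one of its two
    signs; the deficit is the number of edges minus the number of alternations.

    Suppose that a signing has no such component. Then there is a set [X], with more than
    [r] vertices inside and outside, whose boundary avoids plus, and a set [X'] of the same
    kind for minus. The edges in both boundaries are zeros of the signing and each adds 1 to
    the deficit. If the edges at every vertex of exactly one of the two sets contribute half
    of their number, then the deficit is at least the average size of the two boundaries,
    hence at least [c], a contradiction.

    The ordering is made of three kinds of segments, whose deficits add up.
    - Long trails. Two consecutive edges at a vertex which avoid a common sign cost 1, and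
      in a decomposition into a minimal number of trails all but at most two of the edges
      at each vertex are paired in this way ([trail_decomposition]). This gives the half, except
      for the edges from the vertex to [X] and [X'].
    - Double squares. Two four-cycles traversed one after the other from a common base
      point cost one more than half of the edges at the base point
      ([deficit_double_square]). With a linear number of them at each vertex, the gain
      pays for all losses, provided that [X] and [X'] are small ([boundaries_deficit]).
    - Four-cycles [v a w b] in the order [v a], [v b], [w a], [w b]. One costs 1 if it
      belongs to a pair [v, w] separated by a cut whose edges avoid a sign, and the pairs [v, w] can be chosen such that every cut with
      two large sides separates quadratically many of them. Since [c] is at most
      [(r + 1) n], the sets [X] and [X'] can be taken small ([separated_deficit],
      [small_side]).
    The four-cycles are found greedily, because any two vertices have at least [2 n / 3]
    common neighbours ([greedy_packing], [pieces_exist]). *)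

Set Implicit Arguments.
Unset Strict Implicit.
Unset Printing Implicit Defensive.

(** * Alternation of sign words *)

(** The number of runs of equal signs in [w], skipping zeros and not counting a first
    run that continues the sign [p] read before [w]. For [p = None] it is the length of a longest alternating
    subword of [w]. *)
Fixpoint runs_from (p : option bool) (w : seq (option bool)) : nat :=
  match w with
  | [::] => 0
  | None :: w' => runs_from p w'
  | Some b :: w' => (p != Some b) + runs_from (Some b) w'
  end.

Notation alt := (runs_from None).

Lemma runs_from_leS p q w : runs_from p w <= (runs_from q w).+1.
Proof.
elim: w p q => [|[b|] w IH] p q //=.
by case: (p != Some b); case: (q != Some b); rewrite ?add0n ?add1n //; lia.
Qed.

Lemma runs_from_le_alt p w : runs_from p w <= alt w.
Proof. by elim: w => [|[b|] w IH] //=; case: (p != Some b); rewrite ?add0n ?add1n. Qed.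

Lemma runs_from_cat p u v : runs_from p (u ++ v) <= runs_from p u + alt v.
Proof.
elim: u p => [|[b|] u IH] p //=; first exact: runs_from_le_alt.
by rewrite -addnA leq_add2l.
Qed.

Lemma runs_from_size p w : runs_from p w <= size w.
Proof.
elim: w p => [|[b|] w IH] p //=; last exact: leqW.
by case: (p != _); rewrite ?add0n ?add1n ?ltnS //; apply: leqW.
Qed.

Definition extends (a b : option bool) := (a == None) || (a == b).

(** Filling in a zero costs at most one later change of sign, and only when the new
    sign is itself a change. *)
Lemma runs_from_mono (V : Type) (x y : V -> option bool) p (L : seq V) :
  (forall e, extends (x e) (y e)) ->
  runs_from p (map x L) <= runs_from p (map y L).
Proof.
move=> xy; elim: L p => [|e L IH] p //=.
case: (x e) (xy e) => [b|] /=; first by move/eqP <-; rewrite leq_add2l.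
case: (y e) => [b|] //= _.
by case: eqP => [->|_] //=; rewrite add1n (leq_trans (runs_from_leS p (Some b) _)) // ltnS.
Qed.

Fixpoint lead (w : seq (option bool)) : option bool :=
  match w with [::] => None | None :: w' => lead w' | Some b :: _ => Some b end.

Lemma runs_from_lead b w : runs_from (Some b) w + (lead w == Some b) = alt w.
Proof.
elim: w => [|[c|] w IH] //=; rewrite addnC addnA; congr (_ + _).
by case: (b) (c) => [] [].
Qed.

Lemma alt_opp w : alt (map (omap negb) w) = alt w.
Proof.
have H p : runs_from (omap negb p) (map (omap negb) w) = runs_from p w.
  elim: w p => [|[b|] w IH] p //=; rewrite -[in RHS]IH /=; congr (_ + _).
  by case: p => [[]|]; case: b.
exact: (H None).
Qed.

Lemma lead_opp w : lead (map (omap negb) w) = omap negb (lead w).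
Proof. by elim: w => [|[b|] w IH]. Qed.

Lemma lead_None w : (lead w == None) = (alt w == 0).
Proof. by elim: w => [|[b|] w IH]. Qed.

(** If [y] extends [x] and both alternate equally often, then they start with
    the same sign: an earlier opposite sign in [y] would be one more change. *)
Lemma lead_mono (V : Type) (x y : V -> option bool) (L : seq V) :
  (forall e, extends (x e) (y e)) ->
  alt (map x L) = alt (map y L) -> lead (map x L) = lead (map y L).
Proof.
move=> xy E.
case Ey: (lead (map y L)) => [b|]; last first.
  by apply/eqP; rewrite lead_None E -lead_None Ey.
have := runs_from_mono (Some b) L xy.
have := runs_from_lead b (map x L); have := runs_from_lead b (map y L).
rewrite Ey eqxx E; case: eqP => // _; lia.
Qed.

(** * Alternating label lists *)

Definition del {T : Type} i (s : seq T) := take i s ++ drop i.+1 s.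

Fixpoint alternating b (s : seq bool) :=
  if s is c :: s' then (c == b) && alternating (~~ b) s' else true.

(** Deleting the first or the last entry of an alternating word leaves an
    alternating word; any other word has zero or two entries whose deletion
    leaves the given alternating word. *)
Lemma odd_alternating_del b s :
  odd (\sum_(i < size s) alternating b (del i s)) =
  alternating b s (+) alternating (~~ b) s.
Proof.
elim: s b => [|c s IH] b; first by rewrite big_ord0.
have -> : \sum_(i < size (c :: s)) alternating b (del i (c :: s)) =
          alternating b s + (c == b) * \sum_(i < size s) alternating (~~ b) (del i s).
  rewrite /= big_ord_recl /= big_distrr /=; congr (_ + _).
    by rewrite /del /= drop0.
  by apply: eq_bigr => i _; rewrite mulnb.
rewrite oddD oddM IH negbK !oddb /= => {IH}.
by case: c b => [] [] //=; rewrite ?addbb ?addbF // addbC addbK.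
Qed.

(** An absolute value, which may be 0, and a sign ([true] for plus). *)
Notation label := (nat * bool)%type.

Definition leabs : rel label := fun a b => a.1 <= b.1.
Definition alternating_labels b (ls : seq label) :=
  alternating b (map snd (sort leabs ls)).
Definition coherent (ls : seq label) :=
  {in ls &, forall a b : label, a.1 = b.1 -> a = b}.
Definition flip (a : label) : label := (a.1, ~~ a.2).

Lemma leabs_trans : transitive leabs.
Proof. by move=> b a c; apply: leq_trans. Qed.

Lemma leabs_total : total leabs.
Proof. by move=> a b; apply: leq_total. Qed.

Lemma coherent_sub ls ls' : {subset ls' <= ls} -> coherent ls -> coherent ls'.
Proof. by move=> sub co a b /sub la /sub lb; apply: co. Qed.

(** Ties in the order by absolute values are harmless, since labels of one absolute
    value are equal in a coherent list. *)
Lemma sort_coherent ls ls' :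
  coherent ls -> perm_eq ls ls' -> sort leabs ls = sort leabs ls'.
Proof.
move=> co p; apply/perm_sort_inP => //.
- by move=> a b _ _; apply: leabs_total.
- by move=> a b c _ _ _; apply: leabs_trans.
by move=> a b la lb /anti_leq; apply: co.
Qed.

Lemma alternating_flip b ls :
  alternating_labels b (map flip ls) = alternating_labels (~~ b) ls.
Proof.
rewrite /alternating_labels sort_map.
have -> : sort (relpre flip leabs) ls = sort leabs ls by [].
elim: (sort _ _) b => [|[n c] s IH] b //=; rewrite IH.
by case: c b => [] [].
Qed.

Lemma perm_del (T : eqType) (x0 : T) s i :
  i < size s -> perm_eq (del i s) (rem (nth x0 s i) s).
Proof.
move=> lt_i; rewrite -(perm_cons (nth x0 s i)).
apply: (@perm_trans _ s); last by apply: perm_to_rem; apply: mem_nth.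
by rewrite (perm_catCA [:: _]) /= -(drop_nth x0) // cat_take_drop.
Qed.

Lemma del_subset (T : eqType) i (s : seq T) : subseq (del i s) s.
Proof.
rewrite -[X in subseq _ X](cat_take_drop i); apply: cat_subseq => //.
by rewrite -addn1 addnC -drop_drop drop_subseq.
Qed.

(** Deleting an entry commutes with sorting, so this is [odd_alternating_del] for the
    signs in the order of the absolute values. *)
Lemma odd_alternating_labels_del b ls : coherent ls ->
  odd (\sum_(i < size ls) alternating_labels b (del i ls)) =
  alternating_labels b ls (+) alternating_labels (~~ b) ls.
Proof.
move=> co; set t := sort leabs ls.
have pt : perm_eq ls t by rewrite perm_sym perm_sort.
have sz : size ls = size t by apply: perm_size.
have st : sorted leabs t by apply: sort_sorted; apply: leabs_total.
have E s : perm_eq ls s -> \sum_(i < size s) alternating_labels b (del i s) =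
   \sum_(x <- s) alternating_labels b (rem x ls).
  move=> p; rewrite (big_nth (0, true)) big_mkord; apply: eq_bigr => i _.
  congr (nat_of_bool _); rewrite /alternating_labels; congr (alternating _ (map _ _)).
  apply: sort_coherent; first apply: coherent_sub co.
    by move=> a /(mem_subseq (del_subset _ _)); rewrite (perm_mem p).
  apply: perm_trans (perm_del (0, true) (ltn_ord i)) _.
  set x := nth _ _ _; have xs : x \in s by apply: mem_nth.
  rewrite -(perm_cons x); apply: (@perm_trans _ s).
    by rewrite perm_sym perm_to_rem.
  by apply: (@perm_trans _ ls); [rewrite perm_sym | rewrite perm_to_rem ?(perm_mem p)].
rewrite E // (perm_big t) // -E //.
rewrite /alternating_labels -/t -(size_map snd t) -odd_alternating_del size_map.
congr (odd _); apply: eq_bigr => i _; congr (nat_of_bool (alternating _ _)).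
rewrite sorted_sort; first by rewrite map_cat map_take map_drop.
  exact: leabs_trans.
by apply: subseq_sorted st; [exact: leabs_trans | exact: del_subset].
Qed.

Lemma alternating_labels_bound b ls N : coherent ls ->
  alternating_labels b ls -> all (fun a => a.1 < N) ls -> size ls <= N.
Proof.
move=> co al bd; set t := sort leabs ls.
have mt a : (a \in t) = (a \in ls) by rewrite mem_sort.
have st : sorted leabs t by apply: sort_sorted; apply: leabs_total.
have cot : coherent t by apply: coherent_sub co => a; rewrite mt.
have u : sorted ltn (map fst t).
  move: al; rewrite /alternating_labels -/t; move: st cot.
  clear; elim: t b => [|x [|y t] IH] b //= /andP[xy st] cot /and3P[xb yb al].
  apply/andP; split.
    rewrite /= ltn_neqAle; apply/andP; split; last exact: xy.
    apply/eqP=> E; have : x = y.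
      by apply: cot E; rewrite !inE eqxx ?orbT.
    by move=> Exy; move: xb yb; rewrite Exy => /eqP->; case: b {al}.
  apply: (IH (~~ b)) => //=; last by rewrite yb.
  by apply: coherent_sub cot => a ta; rewrite inE ta orbT.
rewrite -(size_sort leabs) -/t -(size_map fst) -[N in _ <= N](size_iota 0).
apply: uniq_leq_size; first by rewrite ltn_sorted_uniq_leq in u; case/andP: u.
move=> n /mapP[a]; rewrite mt mem_iota => /(allP bd) /= + -> //.
Qed.

(** * Ky Fan's lemma for signed permutations *)

Lemma even_involution (T : finType) (A : {set T}) (f : T -> T) :
  {in A, forall x, f x \in A /\ f x != x /\ f (f x) = x} -> odd #|A| = false.
Proof.
elim: {A}#|A| {-2}A (leqnn #|A|) => [|n IH] A.
  by rewrite leqn0 cards_eq0 => /eqP-> _; rewrite cards0.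
move=> szA inv; case: (set_0Vmem A) => [->|[x xA]]; first by rewrite cards0.
have [fxA [nfx ffx]] := inv x xA.
have C : #|A| = (#|A :\ x :\ f x|).+2.
  by rewrite (cardsD1 x) xA (cardsD1 (f x)) !inE nfx fxA.
rewrite C /= negbK; apply: IH; first by move: szA; rewrite C; lia.
move=> y; rewrite !inE => /and3P[y1 y2 yA]; have [fyA [nfy ffy]] := inv y yA.
rewrite fyA nfy ffy andbT; split=> //; apply/andP; split.
  by apply: contra y2 => /eqP E; rewrite -ffy E ffx.
by apply: contra y1 => /eqP E; rewrite -ffy E.
Qed.

Definition swap {T : Type} i (s : seq T) :=
  take i s ++ rev (take 2 (drop i s)) ++ drop i.+2 s.

Lemma swap_cat (T : Type) (u : seq T) x y v :
  swap (size u) (u ++ x :: y :: v) = u ++ y :: x :: v.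
Proof.
rewrite /swap take_size_cat // drop_size_cat //= take0 /=.
by rewrite -[(size u).+2]addn2 addnC -drop_drop drop_size_cat //= drop0.
Qed.

Lemma split2 (T : Type) i (s : seq T) : i.+1 < size s ->
  exists u x y v, s = u ++ x :: y :: v /\ size u = i.
Proof.
move=> lt; have : 1 < size (drop i s) by rewrite size_drop; lia.
case E: (drop i s) => [|x [|y v]] // _; exists (take i s), x, y, v.
by rewrite -E cat_take_drop size_take ifT //; lia.
Qed.

Lemma perm_swap_take (T : eqType) i l (s : seq T) : i.+1 < size s -> l != i ->
  perm_eq (take l.+1 (swap i s)) (take l.+1 s).
Proof.
move=> /split2[u [x [y [v [-> <-]]]]] nl; rewrite swap_cat !take_cat.
case: ltngtP => [//|h|<-]; last by rewrite subnn !take0.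
have -> : l.+1 - size u = (l - size u).-1.+2 by lia.
by rewrite /= perm_cat2l (perm_catCA [:: y] [:: x]).
Qed.

Lemma perm_swap (T : eqType) i (s : seq T) : i.+1 < size s -> perm_eq (swap i s) s.
Proof.
by move=> /split2[u [x [y [v [-> <-]]]]]; rewrite swap_cat perm_cat2l (perm_catCA [:: y] [:: x]).
Qed.

Lemma swapK (T : Type) i (s : seq T) : i.+1 < size s -> swap i (swap i s) = s.
Proof. by move=> /split2[u [x [y [v [-> <-]]]]]; rewrite !swap_cat. Qed.

Lemma sum_nat_of_bool (T : finType) (A : {set T}) (b : pred T) :
  \sum_(w in A) (b w : nat) = #|[set w in A | b w]|.
Proof.
rewrite -sum1_card big_mkcond [RHS]big_mkcond; apply: eq_bigr => w _.
by rewrite inE; case: (w \in A); case: (b w).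
Qed.

Lemma take_nonnil (T : eqType) i (w : seq T) : 0 < size w -> take i.+1 w != [::].
Proof. by case: w. Qed.

Lemma uniq_map_inj (T U : eqType) (f : T -> U) s :
  uniq (map f s) -> {in s &, injective f}.
Proof.
elim: s => // z s IH /= /andP[nz u] x y; rewrite !inE.
case/predU1P=> [->|xs] /predU1P[->|ys] // E; last exact: IH E.
  by rewrite E map_f in nz.
by rewrite -E map_f in nz.
Qed.

Section Fan.
Variables (V : finType) (L : seq V).
Hypothesis uL : uniq L.
Variable lam : seq (V * bool) -> label.

Definition opp (d : V * bool) := (d.1, ~~ d.2).
Definition signed (w : seq (V * bool)) :=
  uniq (map fst w) && all (fun d => d.1 \in L) w.

Hypothesis lam_perm : forall s t, perm_eq s t -> lam s = lam t.
Hypothesis lam_opp : forall s, s != [::] -> signed s ->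
  lam (map opp s) = flip (lam s).
Hypothesis lam_mono : forall s t, s != [::] -> signed (s ++ t) ->
  (lam s).1 = (lam (s ++ t)).1 -> lam s = lam (s ++ t).

(** A word lists signed coordinates. Its prefixes are the sign vectors of a chain in
    the barycentric subdivision of the boundary of a cross-polytope, and [labels]
    reads the labelling [lam] along this chain. *)
Definition labels w := [seq lam (take i.+1 w) | i <- iota 0 (size w)].
Definition upto k (w : seq (V * bool)) :=
  uniq (map fst w) && all (fun d => index d.1 L < k) w.

Lemma size_labels w : size (labels w) = size w.
Proof. by rewrite size_map size_iota. Qed.

Lemma oppK : involutive opp.
Proof. by case=> v b; rewrite /opp /= negbK. Qed.

Lemma upto_signed k w : k <= size L -> upto k w -> signed w.
Proof.
move=> kL /andP[u /allP h]; rewrite /signed u; apply/allP => d /h.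
by rewrite -index_mem => /leq_trans; apply.
Qed.

Lemma signed_take i w : signed w -> signed (take i w).
Proof.
rewrite -{1}(cat_take_drop i w) /signed map_cat cat_uniq all_cat.
by case/andP=> /and3P[-> _ _] /andP[-> _].
Qed.

Lemma upto_opp k w : upto k (map opp w) = upto k w.
Proof.
rewrite /upto -map_comp (eq_map (_ : fst \o opp =1 fst)) //.
by rewrite all_map.
Qed.

Lemma upto_perm k s t : perm_eq s t -> upto k s = upto k t.
Proof.
by move=> p; rewrite /upto (perm_uniq (perm_map fst p)) (perm_all _ p).
Qed.

Lemma labels_coherent w : signed w -> coherent (labels w).
Proof.
move=> sw a b /mapP[i +] + /mapP[j +].
rewrite !mem_iota /= !add0n => li -> lj ->; move: i j li lj.
have H i j : i <= j -> j < size w -> (lam (take i.+1 w)).1 = (lam (take j.+1 w)).1 ->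
   lam (take i.+1 w) = lam (take j.+1 w).
  move=> ij lj; rewrite -(cat_take_drop i.+1 (take j.+1 w)) take_takel //.
  apply: lam_mono; first by apply: take_nonnil; apply: leq_ltn_trans lj.
  by rewrite -(@take_takel _ i.+1 j.+1) // cat_take_drop; apply: signed_take.
move=> i j li lj E; case: (leqP i j) => [|/ltnW] ij; first exact: H.
by apply/esym/H.
Qed.

Lemma labels_opp w : signed w -> labels (map opp w) = map flip (labels w).
Proof.
move=> sw; rewrite /labels size_map -map_comp; apply/eq_in_map => i.
rewrite mem_iota add0n /= => li; rewrite -map_take lam_opp //.
  by apply: take_nonnil; apply: leq_ltn_trans li.
exact: signed_take.
Qed.

Lemma del_map (T U : Type) (f : T -> U) i s : del i (map f s) = map f (del i s).
Proof. by rewrite /del map_cat map_take map_drop. Qed.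

Lemma del_iota i n : i < n -> {in del i (iota 0 n), forall l, l != i /\ l < n}.
Proof.
move=> li l; rewrite /del take_iota drop_iota mem_cat !mem_iota; lia.
Qed.

Lemma labels_swap i w : i.+1 < size w ->
  del i (labels (swap i w)) = del i (labels w).
Proof.
move=> li; rewrite /labels.
have -> : size (swap i w) = size w.
  case/split2: li => u [x [y [v [-> <-]]]]; rewrite swap_cat !size_cat /=; lia.
rewrite !del_map; apply/eq_in_map => l /del_iota[|nl ll]; first lia.
by apply: lam_perm; apply: perm_swap_take.
Qed.

Lemma labels_del_last k w : size w = k.+1 ->
  del k (labels w) = labels (take k w).
Proof.
move=> sw; rewrite /labels sw size_take sw ltnS leqnn del_map.
rewrite /del take_iota drop_iota subSS subnn cats0.
have -> : minn k k.+1 = k by lia.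
apply/eq_in_map => l; rewrite mem_iota add0n => /andP[_ lk].
by rewrite take_takel.
Qed.

Definition positive_words k :=
  [set w : k.-tuple (V * bool) | upto k w & alternating_labels true (labels w)].

Section Step.
Variables (k : nat) (K : V).
Hypothesis kL : k < size L.
Hypothesis iK : index K L = k.

Let W := [set w : k.+1.-tuple (V * bool) | upto k.+1 w].
Let H := [set w in W | (K, true) \in (w : seq _)].

Lemma KL : K \in L. Proof. by rewrite -index_mem iK. Qed.

Lemma word_last (w : k.+1.-tuple (V * bool)) : w \in W ->
  ((K, false) \in (w : seq _)) = ((K, true) \notin (w : seq _)).
Proof.
rewrite inE => /andP[u /allP al].
have Kw : K \in map fst w.
  have sub : {subset map fst w <= take k.+1 L}.
    move=> v /mapP[d /al + ->]; move=> lt.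
    by rewrite in_take_leq.
  have sz : size (take k.+1 L) <= size (map fst w).
    by rewrite size_map size_tuple size_take_min geq_minl.
  have [_ E] := uniq_min_size u sub sz.
  by rewrite E in_take_leq ?iK.
case/mapP: Kw => -[K' b] /= dw EK; rewrite -EK in dw.
have inj : {in w &, injective fst}.
  exact: uniq_map_inj u.
case: b dw => dw; rewrite dw; first by apply/negbTE/negP => /inj /(_ dw erefl).
by apply/esym/negP => /inj /(_ dw erefl).
Qed.

(** Double counting in the hemisphere [H] where the coordinate [K] is positive: pairs
    of a full word and a level whose deletion leaves an alternating label list. On the
    one hand, a word is in an odd number of pairs if and only if its own labels
    alternate, and the antipodal map turns those starting with minus in [H] into those
    starting with plus in the other hemisphere. On the other hand, exchanging two
    neighbouring entries, or changing the sign of the last one, pairs off the words for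
    a given level, except where the last entry is [(K, true)] and the last level is
    deleted; these words are the full words on one coordinate less. *)
Lemma positive_step : odd #|positive_words k.+1| = odd #|positive_words k|.
Proof.
pose P b (w : k.+1.-tuple (V * bool)) := alternating_labels b (labels w).
pose Q i (w : k.+1.-tuple (V * bool)) := alternating_labels true (del i (labels w)).
have sW (w : k.+1.-tuple (V * bool)) : w \in W -> signed w.
  by rewrite inE; apply: upto_signed.
(* The antipodal map sends the other hemisphere to [H]. *)
have E1 : #|positive_words k.+1| =
    #|[set w in H | P true w]| + #|[set w in H | P false w]|.
  rewrite -(cardsID [set w : k.+1.-tuple (V * bool) | (K, true) \in (w : seq _)] (positive_words _)).
  congr (_ + _); first by apply: eq_card => w; rewrite !inE andbAC.
  pose f (w : k.+1.-tuple (V * bool)) := map_tuple opp w.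
  have fK : involutive f by move=> w; apply: val_inj; rewrite /= mapK //; apply: oppK.
  rewrite -(on_card_preimset (f := f)); last by exists f => w _; apply: fK.
  apply: eq_card => w; rewrite !inE /= upto_opp /P.
  case: (boolP (upto _ _)) => [uw|_]; last by rewrite andbF.
  have wW : w \in W by rewrite inE.
  rewrite labels_opp ?sW // alternating_flip /=; congr (_ && _).
  have -> : (K, true) = opp (K, false) by [].
  by rewrite mem_map ?word_last ?negbK //; apply: inv_inj oppK.
have E2 : odd #|positive_words k.+1| =
    odd (\sum_(i < k.+1) #|[set w in H | Q i w]|).
  transitivity (odd (\sum_(w in H) \sum_(i < k.+1) Q i w)); last first.
    rewrite exchange_big; congr (odd _); apply: eq_bigr => i _.
    exact: sum_nat_of_bool.
  rewrite E1 -!sum_nat_of_bool -big_split /= !(big_morph odd oddD (erefl : odd 0 = false)).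
  apply: eq_bigr => w; rewrite inE => /andP[/sW sw _].
  have := odd_alternating_labels_del true (labels_coherent sw).
  by rewrite size_labels size_tuple oddD !oddb => ->.
rewrite E2 big_ord_recr /= oddD.
(* A level below the top is unaffected by the exchange of its two neighbouring steps. *)
rewrite (big_morph odd oddD (erefl : odd 0 = false)) big1 /=; last first.
  move=> i _.
  pose f (w : k.+1.-tuple (V * bool)) : k.+1.-tuple (V * bool) := insubd w (swap i w).
  have li (w : k.+1.-tuple (V * bool)) : i.+1 < size w by rewrite size_tuple ltnS.
  have fE w : f w = swap i w :> seq _.
    by rewrite val_insubd (perm_size (perm_swap (li w))) size_tuple eqxx.
  apply: (@even_involution _ _ f) => w; rewrite !inE /Q fE labels_swap // => /andP[/andP[uw Kw] ->].
  rewrite andbT (perm_mem (perm_swap (li w))) Kw (upto_perm _ (perm_swap (li w))) uw.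
  split=> //; split; last by apply: val_inj; rewrite /= fE fE swapK.
  rewrite -val_eqE /= fE; case/andP: uw => /map_uniq + _.
  have [u [x [y [v [-> <-]]]]] := split2 (li w); rewrite swap_cat.
  rewrite cat_uniq /= => /and5P[_ _ + _ _]; rewrite inE negb_or eqseq_cat // eqxx /= eqseq_cons.
  by case/andP=> + _; rewrite eq_sym => /negbTE->.
(* At the top, the sign of the last entry is free unless its coordinate is [K]. *)
rewrite -(cardsID [set w : k.+1.-tuple (V * bool) | (last (K, true) w).1 == K]).
rewrite oddD addbC (_ : odd #|_ :\: _| = false) /=; last first.
  pose f (w : k.+1.-tuple (V * bool)) : k.+1.-tuple (V * bool) :=
    insubd w (rcons (take k w) (opp (last (K, true) w))).
  have fE w : f w = rcons (take k w) (opp (last (K, true) w)) :> seq _.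
    by rewrite val_insubd size_rcons size_take size_tuple ltnSn eqxx.
  have wE (w : k.+1.-tuple (V * bool)) : w = rcons (take k w) (last (K, true) w) :> seq _.
    have [u [d E]] : exists u d, w = rcons u d :> seq _.
      by case/lastP: (w : seq _) (size_tuple w) => // u d _; exists u, d.
    have su : size u = k by have := size_tuple w; rewrite E size_rcons => -[].
    by rewrite E last_rcons -cats1 take_size_cat ?cats1.
  apply: (@even_involution _ _ f) => w; rewrite !inE /Q fE last_rcons /=.
  rewrite !labels_del_last ?size_tuple ?size_rcons ?size_take ?size_tuple ?ltnSn //.
  rewrite -cats1 take_size_cat ?size_take ?size_tuple ?ltnSn //.
  move=> /and3P[nK /andP[uw Kw] ->].
  have -> : upto k.+1 (take k w ++ [:: opp (last (K, true) w)]).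
    by move: uw; rewrite {1}wE cats1 /upto !map_rcons !all_rcons.
  have -> : (K, true) \in take k w ++ [:: opp (last (K, true) w)].
    move: Kw; rewrite {1}wE mem_rcons mem_cat !inE; case/predU1P=> [E|->] //.
    by rewrite -E eqxx in nK.
  rewrite nK; split=> //; split.
    rewrite -val_eqE /= fE; apply/eqP => E.
    have := congr1 (last (K, true)) E; rewrite last_rcons.
    by case: (last _ _) => v [].
  apply: val_inj; rewrite /= fE fE last_rcons oppK.
  rewrite -(cats1 (take k w) (opp _)) take_size_cat; first by rewrite -wE.
  by rewrite size_take size_tuple ltnSn.
  by rewrite (minn_idPl (leqnSn k)).
congr (odd _); pose f (w : k.-tuple (V * bool)) := [tuple of rcons w (K, true)].
rewrite -(card_imset (f := f)); last first.
  by move=> u v /(congr1 val) /= /rcons_inj[] /val_inj.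
have iKE d : (index d L == k) = (d == K).
  apply/eqP/eqP => [E|->] //; have dL : d \in L by rewrite -index_mem E.
  by rewrite -(nth_index K dL) E -iK nth_index // KL.
have uE u : upto k.+1 (rcons u (K, true)) = upto k u.
  rewrite /upto map_rcons rcons_uniq all_rcons /= iK ltnSn /=.
  apply/andP/andP => [[/andP[nK ->] al]|[-> al]]; split=> //.
    apply/allP => d du; move/allP: al => /(_ d du); rewrite ltnS leq_eqVlt iKE.
    by case: eqP => // E; rewrite -E map_f in nK.
    rewrite andbT; apply/negP => /mapP[d du E]; move/allP: al => /(_ d du).
    by rewrite -E iK ltnn.
  by apply: sub_all al => d; apply: leqW.
apply: eq_card => w; rewrite !inE.
apply/idP/imsetP => [|[u]].
  case/andP=> /andP[/andP[uw Kw] q] /eqP lK.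
  have [s [d E]] : exists u d, w = rcons u d :> seq _.
    by case/lastP: (w : seq _) (size_tuple w) => // u d _; exists u, d.
  have ss : size s == k by have := size_tuple w; rewrite E size_rcons => -[->].
  have Ed : d = (K, true).
    move: uw lK Kw; rewrite E last_rcons /upto map_rcons rcons_uniq mem_rcons inE.
    case: d {E} => v b /= /andP[/andP[nv _] _] Ev; rewrite Ev in nv *.
    by case/predU1P => [//|/(map_f fst)]; rewrite (negbTE nv).
  exists (Tuple ss); last by apply: val_inj; rewrite /= E Ed.
  move: uw q; rewrite inE /Q labels_del_last ?size_tuple // E Ed uE => ->.
  by rewrite -cats1 take_size_cat // (eqP ss).
rewrite inE => /andP[uu al] ->; rewrite /Q labels_del_last ?size_tuple //=.
rewrite uE uu last_rcons eqxx mem_rcons inE eqxx /= andbT.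
by rewrite -cats1 take_size_cat // size_tuple.
Qed.

End Step.

Lemma odd_positive_words k : k <= size L -> odd #|positive_words k|.
Proof.
elim: k => [_|k IH kL].
  rewrite (_ : positive_words 0 = [set [tuple]]) ?cards1 //.
  by apply/setP => w; rewrite !inE tuple0 eqxx.
have [K iK] : exists K, index K L = k.
  case E: L kL uL => [|K0 L'] // kL _; exists (nth K0 L k).
  by rewrite -E index_uniq // E.
by rewrite (positive_step kL iK); apply/IH/ltnW.
Qed.

(** The label bound of Ky Fan's theorem: along the chain of prefixes of some
    full sign word the labels alternate, hence have distinct absolute values. *)
Lemma fan_label_bound N :
  (forall s, s != [::] -> signed s -> (lam s).1 < N) -> size L <= N.
Proof.
move=> bd; have := odd_positive_words (leqnn (size L)).
case: (set_0Vmem (positive_words (size L))) => [->|[w]]; first by rewrite cards0.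
rewrite inE => /andP[/(upto_signed (leqnn _)) sw al] _.
rewrite -[size L](size_tuple w) -size_labels.
apply: alternating_labels_bound al _; first exact: labels_coherent.
apply/allP => a /mapP[i]; rewrite mem_iota add0n => /andP[_ li] ->.
apply: bd; last exact: signed_take.
by apply: take_nonnil; apply: leq_ltn_trans li.
Qed.

End Fan.

(** * A lower bound for Kneser graphs *)

Lemma alt_gt0 w : has (fun a => a != None) w -> 0 < alt w.
Proof. by elim: w => [|[b|] w IH]. Qed.

Section Kneser.
Variables (V F : finType) (L : seq V) (supp : F -> {set V}).
Variables (C alpha : nat) (col : F -> 'I_C).
Hypothesis uL : uniq L.
Hypothesis col_disjoint : forall S T,
  [disjoint supp S & supp T] -> col S != col T.
Hypothesis long_mono : forall x : V -> option bool, alpha < alt (map x L) ->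
  exists S b, forall e, e \in supp S -> x e = Some b.

Implicit Type x y : V -> option bool.

Definition mono_set b x S := [forall e in supp S, x e == Some b].
Definition max_color x := \max_(S | mono_set true x S || mono_set false x S) col S.
(** A nonzero vector has at least one run, so the predecessors of the small alternation
    numbers fill the [alpha] values below those used for the colours. *)
Definition sign_label x : label :=
  let w := map x L in
  if alt w <= alpha then ((alt w).-1, lead w == Some true)
  else (alpha + max_color x, [exists S, mono_set true x S && (col S == max_color x :> nat)]).

Definition sign_vector (s : seq (V * bool)) e : option bool :=
  if (e, true) \in s then Some true
  else if (e, false) \in s then Some false else None.

Lemma max_color_attained x : alpha < alt (map x L) ->
  exists S b, mono_set b x S /\ col S = max_color x :> nat.
Proof.
case/long_mono=> S [b mS].
have mS' : mono_set b x S by apply/forall_inP => e /mS ->.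
have [|T mT E] := @eq_bigmax_cond _ [pred S | mono_set true x S || mono_set false x S] (fun S => col S).
  by apply/card_gt0P; exists S; rewrite inE; case: b mS' {mS} => ->; rewrite ?orbT.
exists T; case/orP: mT => mT; [exists true|exists false]; split=> //; exact/esym.
Qed.

Lemma mono_set_col x S T : mono_set true x S -> mono_set false x T ->
  col S != col T.
Proof.
move=> /forall_inP mS /forall_inP mT; apply: col_disjoint.
rewrite disjoint_subset; apply/subsetP => e /mS /eqP E; rewrite inE.
by apply/negP => /mT; rewrite E.
Qed.

Lemma mono_set_ext b x y S : (forall e, extends (x e) (y e)) ->
  mono_set b x S -> mono_set b y S.
Proof.
move=> xy /forall_inP mS; apply/forall_inP => e eS.
by case/orP: (xy e) (mS e eS) => /eqP->.
Qed.

Lemma mono_set_opp b x S : mono_set b (omap negb \o x) S = mono_set (~~ b) x S.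
Proof.
apply: eq_forallb_in => e _ /=; case: (x e) => [c|] //=.
by case: c b => [] [].
Qed.

Lemma max_color_opp x : max_color (omap negb \o x) = max_color x.
Proof. by apply: eq_bigl => S; rewrite !mono_set_opp orbC. Qed.

Lemma sign_label_opp x : has (fun e => x e != None) L ->
  sign_label (omap negb \o x) = flip (sign_label x).
Proof.
move=> nx; rewrite /sign_label max_color_opp.
have -> : [seq (omap negb \o x) i | i <- L] = map (omap negb) (map x L) by rewrite -map_comp.
rewrite alt_opp lead_opp; case: leqP => /= [_|h]; rewrite /flip /=; congr (_, _).
  case: (lead _) (lead_None (map x L)) => [[]|] //=; rewrite eqxx => /esym.
  by rewrite eqn0Ngt alt_gt0 // has_map.
have [S [b [mS cS]]] := max_color_attained h.
apply/existsP/idP => [[T]|].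
  rewrite mono_set_opp => /andP[mT /eqP cT]; apply/existsPn => U.
  apply/negP => /andP[mU /eqP cU]; have := mono_set_col mU mT.
  by rewrite -(inj_eq val_inj) /= cU cT eqxx.
move=> /existsPn nT; exists S; rewrite mono_set_opp cS eqxx andbT.
by case: b mS => // mS; have := nT S; rewrite mS cS eqxx.
Qed.

Lemma sign_label_mono x y : has (fun e => x e != None) L ->
  (forall e, extends (x e) (y e)) ->
  (sign_label x).1 = (sign_label y).1 -> sign_label x = sign_label y.
Proof.
move=> nx xy; have le := runs_from_mono None L xy.
have ax : 0 < alt (map x L) by rewrite alt_gt0 // has_map.
rewrite /sign_label; case: leqP => hx; case: leqP => hy /= E; last 1 first.
- have {}E : max_color x = max_color y by apply/eqP; rewrite -(eqn_add2l alpha) E.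
  rewrite E; congr pair.
  have [S [b [mS cS]]] := max_color_attained hx.
  apply/existsP/existsP => -[T /andP[mT cT]].
    by exists T; rewrite (mono_set_ext xy mT).
  case: b mS => mS; first by exists S; rewrite mS cS E eqxx.
  have := mono_set_col mT (mono_set_ext xy mS).
  by rewrite -(inj_eq val_inj) /= cS (eqP cT) E eqxx.
- have E' : alt (map x L) = alt (map y L) by lia.
  by rewrite E' (lead_mono xy E').
- by lia.
- by lia.
Qed.

Lemma sign_vector_opp s : uniq (map fst s) ->
  sign_vector (map (@opp V) s) = omap negb \o sign_vector s.
Proof.
move=> u; apply/funext => e; rewrite /sign_vector /=.
have H b : ((e, b) \in map (@opp V) s) = ((e, ~~ b) \in s).
  have -> : (e, b) = opp (e, ~~ b) by rewrite /opp /= negbK.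
  by rewrite mem_map //; apply: inv_inj (@oppK V).
rewrite !H /=; case: ifP => f; case: ifP => t //.
by have := uniq_map_inj u t f erefl.
Qed.

Lemma sign_vector_cat s t : uniq (map fst (s ++ t)) ->
  forall e, extends (sign_vector s e) (sign_vector (s ++ t) e).
Proof.
move=> u e; rewrite /sign_vector /extends !mem_cat.
case: ifP => //= ts; case: ifP => //= fs.
case: ifP => // tt; have := @uniq_map_inj _ _ fst (s ++ t) u (e, true) (e, false).
by rewrite !mem_cat ts tt fs => /(_ isT isT erefl).
Qed.

Lemma sign_vector_nonzero s : s != [::] -> signed L s ->
  has (fun e => sign_vector s e != None) L.
Proof.
case: s => // -[e b] s _ /andP[_ /= /andP[eL _]]; apply/hasP; exists e => //.
by rewrite /sign_vector !inE; case: b; rewrite eqxx //=; case: ifP.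
Qed.

(** The general lower bound for Kneser graphs through alternating sign words:
    a proper colouring turns sign vectors into Fan labels, a vector with few
    alternations being labelled by their number and any other one by the
    largest colour of a set it contains. *)
Lemma kneser_alternation_bound : size L <= alpha + C.
Proof.
apply: (@fan_label_bound _ _ uL (sign_label \o sign_vector)).
- move=> s t p /=; congr sign_label; apply/funext => e.
  by rewrite /sign_vector !(perm_mem p).
- move=> s ns ss /=; rewrite sign_vector_opp ?sign_label_opp //.
    exact: sign_vector_nonzero.
  by case/andP: ss.
- move=> s t ns st /= ; apply: sign_label_mono; last first.
    by apply: sign_vector_cat; case/andP: st.
  apply: sign_vector_nonzero => //.
  by move: (signed_take (size s) st); rewrite take_size_cat.
move=> s ns ss /=; rewrite /sign_label; case: (leqP _ alpha) => h /=.
  have := alt_gt0 (w := map (sign_vector s) L).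
  rewrite has_map => /(_ (sign_vector_nonzero ns ss)) a0.
  by apply: leq_trans (leq_addr C alpha); rewrite prednK.
rewrite ltn_add2l; have [S [b [_ <-]]] := max_color_attained h.
exact: ltn_ord.
Qed.

End Kneser.

(** * Deficits of sign words *)

(** What the word [w] falls short of alternating at every position. *)
Definition deficit (w : seq (option bool)) := size w - alt w.

Lemma deficitE w : deficit w + alt w = size w.
Proof. by rewrite subnK // runs_from_size. Qed.

(** Superadditivity: losses in disjoint segments of the ordering add up. *)
Lemma deficit_cat u v : deficit u + deficit v <= deficit (u ++ v).
Proof.
have := runs_from_cat None u v; have := deficitE (u ++ v).
have := deficitE u; have := deficitE v; rewrite size_cat; lia.
Qed.

Lemma deficit_flatten (I : Type) (f : I -> seq (option bool)) (r : seq I) :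
  \sum_(i <- r) deficit (f i) <= deficit (flatten (map f r)).
Proof.
elim: r => [|i r IH]; first by rewrite big_nil.
by rewrite big_cons (leq_trans _ (deficit_cat _ _)) // leq_add2l.
Qed.

Lemma deficit_zero (a : option bool) : (a == None) <= deficit [:: a].
Proof. by case: a. Qed.

Lemma deficit_pair b (a c : option bool) : a != Some b -> c != Some b ->
  0 < deficit [:: a; c].
Proof. by case: a => [[]|]; case: c => [[]|]; case: b. Qed.

Lemma deficit_cons a w : (a == None) + deficit w <= deficit (a :: w).
Proof.
by apply: leq_trans (deficit_cat [:: a] w); rewrite leq_add2r deficit_zero.
Qed.

Definition all3 (P : option bool -> bool) := [&& P None, P (Some true) & P (Some false)].

Lemma all3P P : all3 P -> forall a, P a.
Proof. by case/and3P=> p1 p2 p3 [[]|]. Qed.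

(** A word on the edges of two closed four-step walks with a common base point:
    the edges at the base point are in positions 1, 4, 5, 8, so consecutive ones
    are always at odd distance and three entries are lost if all of them avoid
    one sign. *)
Lemma deficit_octo b a1 a2 a3 a4 a5 a6 a7 a8 :
  a1 != Some b -> a4 != Some b -> a5 != Some b -> a8 != Some b ->
  3 <= deficit [:: a1; a2; a3; a4; a5; a6; a7; a8].
Proof.
have := erefl : all3 (fun b' => all3 (fun a1 => all3 (fun a2 => all3 (fun a3 => all3 (fun a4 =>
  all3 (fun a5 => all3 (fun a6 => all3 (fun a7 => all3 (fun a8 =>
   [|| b' == None, a1 == b', a4 == b', a5 == b', a8 == b' |
    2 < deficit [:: a1; a2; a3; a4; a5; a6; a7; a8]]))))))))).
move/all3P/(_ (Some b))/all3P/(_ a1)/all3P/(_ a2)/all3P/(_ a3)/all3P/(_ a4).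
move/all3P/(_ a5)/all3P/(_ a6)/all3P/(_ a7)/all3P/(_ a8) => /=.
by do 4 case: eqP => //.
Qed.

(** Reading [v a], [v b], [w a], [w b] in this order, the two edges at [a] are in odd
    positions and the two edges at [b] in even ones. If [v] and [w] are separated, then
    so is one edge of each kind. *)
Lemma deficit_quad b a1 a2 a3 a4 :
  (a1 != Some b) || (a3 != Some b) -> (a2 != Some b) || (a4 != Some b) ->
  1 <= deficit [:: a1; a2; a3; a4].
Proof.
by case: b a1 a2 a3 a4 => [] [[]|] [[]|] [[]|] [[]|].
Qed.

(** * Deficits along trails *)

Section TrailCost.
Variable G : sgraph.
Implicit Types (u v z : G) (s : seq G).

Definition trail_edges (t : G * seq G) : seq {set G} :=
  pairmap (fun u v => [set u; v]) t.1 t.2.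

(** Interior visits of vertices in [P] with both neighbours on the trail in [O]. When [P]
    and [O] are disjoint, different clean visits use disjoint pairs of edges. *)
Fixpoint clean_visits (O P : pred G) u s : nat :=
  if s is v :: s' then
    (if s' is w :: _ then O u && P v && O w : nat else 0) + clean_visits O P v s'
  else 0.

Lemma sum_clean_visits (O S : pred G) u s :
  \sum_(z | S z) clean_visits O (pred1 z) u s = clean_visits O S u s.
Proof.
elim: s u => [|v s IH] u /=; first by rewrite big1.
rewrite big_split /= IH; congr (_ + _); case: s {IH} => [|w s]; first by rewrite big1.
case: (O u) => /=; last by rewrite big1.
case: (O w) => /=; last by rewrite andbF big1 // => z _; rewrite andbF.
rewrite andbT; case: (boolP (S v)) => Sv.
  rewrite (bigD1 v) //= eqxx big1 // => z /andP[_ /negbTE nz].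
  by rewrite eq_sym nz.
by rewrite big1 // => z Sz; case: eqP => // E; rewrite E Sz in Sv.
Qed.

Section Cost.
Variables (x : {set G} -> option bool) (O S : pred G) (F : pred {set G}).
Variable sgn : G -> bool.
Hypothesis SO : forall z, S z -> ~~ O z.
Hypothesis SOsgn : forall z u, S z -> O u -> adj z u -> x [set z; u] != Some (sgn z).
Hypothesis F0 : forall e, F e -> x e = None.
Hypothesis SOF : forall z u, S z -> O u -> ~~ F [set z; u].

Lemma deficit_count_zero (E : seq {set G}) : count F E <= deficit (map x E).
Proof.
elim: E => //= e E IH; apply: leq_trans (deficit_cons _ _); rewrite leq_add //.
by case: (boolP (F e)) => // /F0 ->.
Qed.

(** The two edges of a clean visit are consecutive and avoid a common sign. Consecutive
    kept edges have opposite signs, so one entry is lost. *)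
Lemma deficit_trail t : path adj t.1 t.2 ->
  clean_visits O S t.1 t.2 + count F (trail_edges t) <= deficit (map x (trail_edges t)).
Proof.
case: t => u s; rewrite /trail_edges /=.
elim: {s}(size s) {-2}s (leqnn (size s)) u => [|n IH] [|v s] //= ss u /andP[uv ps].
have skip : clean_visits O S v s + (F [set u; v] +
   count F (pairmap (fun u v => [set u; v]) v s)) <=
   deficit (x [set u; v] :: map x (pairmap (fun u v => [set u; v]) v s)).
  apply: leq_trans (deficit_cons _ _); rewrite addnCA; apply: leq_add; last exact: IH.
  by case: (boolP (F _)) => // /F0 ->.
case: s ss ps skip => [|w s] ss ps skip; first by rewrite add0n.
case: (boolP (O u && S v && O w)) => [/andP[/andP[Ou Sv] Ow]|_]; last by rewrite add0n.
move: ps => /= /andP[vw ps].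
have ss' : size s <= n by apply: ltnW.
have H := IH s ss' w ps.
rewrite {1}setUC (negbTE (SOF Sv Ou)) (negbTE (SOF Sv Ow)).
have -> : (if s is w0 :: _ then O v && S w && O w0 : nat else 0) = 0.
  by case: (s) => // w0 _; rewrite (negbTE (SO Sv)).
apply: leq_trans (deficit_cat [:: _; _] _); rewrite !add0n -addnA leq_add //.
apply: (@deficit_pair (sgn v)); last exact: SOsgn.
by rewrite setUC; apply: SOsgn; rewrite // adj_sym.
Qed.

Hypothesis OOF : forall u v, O u -> O v -> ~~ F [set u; v].

Definition double_square (v a w b c y d : G) : G * seq G :=
  (v, [:: a; w; b; v; c; y; d; v]).

(** The edges at the base point [v] cost three instead of the single visit of
    [v] in the middle of the walk. *)
Lemma deficit_double_square v a w b c y d (t := double_square v a w b c y d) :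
  path adj t.1 t.2 -> S v -> all O [:: a; w; b; c; y; d] ->
  clean_visits O S t.1 t.2 + count F (trail_edges t) + 2 <=
  deficit (map x (trail_edges t)).
Proof.
rewrite /t /= => {t} /and5P[va aw wb bv /and5P[vc cy yd dv _]] Sv.
case/and5P=> Oa Ow Ob Oc /and3P[Oy Od _].
have SN u : O u -> S u = false.
  by move=> Ou; apply/negP => /SO; rewrite Ou.
rewrite /trail_edges /= (negbTE (SO Sv)) Oa Ow Ob Oc Oy Od Sv !SN //=.
have FN u : O u -> F [set v; u] = false by move=> Ou; apply/negbTE/SOF.
have FN' u : O u -> F [set u; v] = false by rewrite setUC; exact: FN.
have FO u u' : O u -> O u' -> F [set u; u'] = false by move=> Ou Ou'; apply/negbTE/OOF.
rewrite !FN ?FN' ?FO //.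
apply: (@deficit_octo (sgn v)); try by apply: SOsgn.
  by rewrite setUC; apply: SOsgn; rewrite // adj_sym.
by rewrite setUC; apply: SOsgn; rewrite // adj_sym.
Qed.

End Cost.

(** An edge at [z] whose other end is not in [O]: it can make a visit of [z] unclean. *)
Definition bad (O : pred G) z (e : {set G}) :=
  (z \in e) && [exists u in e, (u != z) && ~~ O u].

Lemma bad_edge (O : pred G) z u v : u != v ->
  bad O z [set u; v] = (u == z) && ~~ O v || (v == z) && ~~ O u.
Proof.
move=> uv; rewrite /bad !inE ![z == _]eq_sym; apply/andP/orP.
  case=> zuv /exists_inP[w]; rewrite !inE => /orP[]/eqP-> /andP[nz nO].
    by rewrite (negbTE nz) /= in zuv; right; rewrite nO zuv.
  by rewrite (negbTE nz) orbF in zuv; left; rewrite nO zuv.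
case=> /andP[/eqP<- nO]; rewrite eqxx ?orbT; split=> //; apply/exists_inP.
  by exists v; rewrite ?inE ?eqxx ?orbT //= eq_sym uv.
by exists u; rewrite ?inE ?eqxx ?orbT //= uv.
Qed.

Lemma adj_neq u v : adj u v -> u != v.
Proof. by apply: contraTneq => ->; rewrite adj_irrefl. Qed.

(** The edges at [z] are paired by the visits of [z], up to the ends of the trail, and
    every unclean visit contains a bad edge. *)
Lemma trail_degree (O : pred G) z t : path adj t.1 t.2 ->
  count (fun e : {set G} => z \in e) (trail_edges t) <=
  2 * clean_visits O (pred1 z) t.1 t.2 + 2 * count (bad O z) (trail_edges t) +
  (t.1 == z) + (last t.1 t.2 == z).
Proof.
case: t => u s; rewrite /trail_edges /= => ps.
(* A bad first edge at [z] also has to pay for the edge by which a longer trail enters [z]. *)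
suff : count (fun e : {set G} => z \in e) (pairmap (fun u v => [set u; v]) u s) +
   (if s is v :: _ then 2 * ((u == z) && ~~ O v) else 0) <=
  2 * clean_visits O (pred1 z) u s +
  2 * count (bad O z) (pairmap (fun u v => [set u; v]) u s) +
  (u == z) + (last u s == z) by apply: leq_trans; rewrite leq_addr.
elim: s u ps => [|v s IH] u //= /andP[uv ps].
have {IH} := IH v ps; have := adj_neq uv; move=> nuv.
rewrite (bad_edge _ _ nuv) !inE ![z == _]eq_sym.
set c := count _ _; set cv := clean_visits _ _ _ _; set cb := count _ _.
case: (eqVneq u z) => [Eu|_] /=.
  rewrite -Eu; rewrite eq_sym in nuv; rewrite (negbTE nuv) /= !orbF.
  have -> : (if s is w :: _ then O u && false && O w : nat else 0) = 0.
    by case: (s) => // w _; rewrite andbF.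
  by move/(leq_trans (leq_addr _ _)); case: (O v) => /=; lia.
case: (eqVneq v z) => [Ev|_] /=; last first.
  have -> : (if s is w :: _ then O u && false && O w : nat else 0) = 0.
    by case: (s) => // w _; rewrite andbF.
  move/(leq_trans (leq_addr _ _)); lia.
rewrite /c /cv /cb; case: s {ps c cv cb} => [|w s] /=; first by rewrite Ev eqxx; lia.
rewrite andbT; case: (O u); case: (O w) => /=; lia.
Qed.

End TrailCost.

(** * Packing four-cycles *)

Section Packing.
Variables (T : finType) (e : rel T).
Hypothesis e_irr : irreflexive e.

(** [((v, w), (a, b))] stands for the four-cycle [v a w b]. *)
Definition quad := ((T * T) * (T * T))%type.
Implicit Types (q : quad) (R : seq quad) (Q : seq (T * T)) (z : T).

Definition quad_edges q : seq {set T} :=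
  [:: [set q.1.1; q.2.1]; [set q.1.1; q.2.2]; [set q.1.2; q.2.1]; [set q.1.2; q.2.2]].
Definition is_quad q :=
  [&& e q.1.1 q.2.1, e q.1.1 q.2.2, e q.1.2 q.2.1 & e q.1.2 q.2.2].
Definition packing_edges R := flatten (map quad_edges R).
Definition load z (Q : seq (T * T)) :=
  count_mem z (map fst Q) + count_mem z (map snd Q).

Lemma sum_count_mem (s : seq T) : \sum_z count_mem z s = size s.
Proof.
elim: s => [|a s IH]; first by rewrite big1.
rewrite big_split /= IH -add1n; congr (_ + _).
by rewrite (bigD1 a) //= eqxx big1 // => z /negbTE; rewrite eq_sym => ->.
Qed.

Lemma sum_load Q : \sum_z load z Q = 2 * size Q.
Proof. by rewrite big_split /= !sum_count_mem !size_map mul2n addnn. Qed.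

Lemma degree_packing z R :
  count (fun d : {set T} => z \in d) (packing_edges R) <=
  2 * load z (map fst R) + 2 * load z (map snd R).
Proof.
elim: R => [|q R IH] //; rewrite /packing_edges /= -/(packing_edges R).
move: IH; set c := count _ (packing_edges R); rewrite /load /= => IH.
rewrite !inE ![z == _]eq_sym.
by case: (q.1.1 == z); case: (q.1.2 == z); case: (q.2.1 == z); case: (q.2.2 == z) => /=; lia.
Qed.

Lemma set2_inj (v a b : T) : [set v; a] = [set v; b] -> a = b.
Proof.
move=> E; have: a \in [set v; b] by rewrite -E set22.
have: b \in [set v; a] by rewrite E set22.
by rewrite !inE => /orP[/eqP->|/eqP->] // /orP[]/eqP->.
Qed.

Lemma card_used z (E : seq {set T}) :
  #|[set a | [set z; a] \in E]| <= count (fun d : {set T} => z \in d) E.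
Proof.
rewrite -size_filter -(card_imset _ (@set2_inj z)).
apply: leq_trans (card_size _); apply: subset_leq_card; apply/subsetP => d.
by case/imsetP=> a; rewrite inE => aE ->; rewrite mem_filter aE set21.
Qed.

Lemma pick2 (A : {set T}) : 1 < #|A| -> exists a b, [/\ a \in A, b \in A & a != b].
Proof. by case/card_gt1P=> a [b [aA bA ab]]; exists a, b. Qed.

(** Greedy choice: when a pair is served, the common neighbours that are unusable
    are those joined to it by a used edge and those which reached the load [t], and
    there are few of both kinds. *)
Lemma greedy_packing Q (p t h : nat) :
  all (fun c : T * T => c.1 != c.2) Q -> (forall z, load z Q <= p) ->
  0 < t -> 2 * size Q <= t * h ->
  (forall v w, v != w -> h + 4 * p + 4 * t + 2 <= #|[set a | e v a && e w a]|) ->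
  exists R, [/\ map fst R = Q, all is_quad R, uniq (packing_edges R) &
                forall z, load z (map snd R) <= t].
Proof.
move=> nQ lQ t0 + cn; elim: Q nQ lQ => [|[v w] Q IH] /=; first by exists [::].
case/andP=> vw nQ lQ szQ.
have [||R [RQ qR uR lR]] := IH nQ; first by move=> z; apply: leq_trans (lQ z); rewrite /load /=; lia.
  by apply: leq_trans szQ; rewrite leq_pmul2l.
pose used z := [set a | [set z; a] \in packing_edges R].
pose heavy := [set a | t <= load a (map snd R)].
have used_le z : #|used z| <= 2 * p + 2 * t.
  apply: leq_trans (card_used _ _) _; apply: leq_trans (degree_packing _ _) _.
  rewrite RQ leq_add // leq_pmul2l //; apply: leq_trans (lQ z); rewrite /load /=; lia.
have heavy_le : #|heavy| <= h.
  rewrite -(leq_pmul2l t0); apply: leq_trans szQ.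
  have sR : size (map snd R) <= (size Q).+1 by rewrite size_map -RQ size_map.
  apply: leq_trans (_ : 2 * size (map snd R) <= _); last by rewrite leq_pmul2l.
  rewrite -sum_load mulnC -sum_nat_const.
  rewrite [X in _ <= X](bigID (mem heavy)) /=; apply: leq_trans (leq_addr _ _).
  by apply: leq_sum => z; rewrite inE.
pose A := [set a | e v a && e w a] :\: (heavy :|: (used v :|: used w)).
have cA : 1 < #|A|.
  have := cn v w vw; rewrite -(cardsID (heavy :|: (used v :|: used w))).
  have : #|[set a | e v a && e w a] :&: (heavy :|: (used v :|: used w))| <= h + 4 * p + 4 * t.
    apply: leq_trans (subset_leq_card (subsetIr _ _)) _.
    apply: leq_trans (leq_card_setU _ _) _.
    have := (leq_card_setU (used v) (used w)).1; have := used_le v; have := used_le w.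
    by move: heavy_le; lia.
  rewrite -/A; lia.
have [a [b [aA bA ab]]] := pick2 cA.
move: aA bA; rewrite !inE !negb_or -!ltnNge.
case/andP=> /and3P[la va wa] /andP[eva ewa] /andP[/and3P[lb vb wb] /andP[evb ewb]].
have neq x y : e x y -> x != y by apply: contraTneq => ->; rewrite e_irr.
exists (((v, w), (a, b)) :: R); split; first by rewrite /= RQ.
- by rewrite /= qR andbT /is_quad /= eva evb ewa ewb.
- rewrite /packing_edges /= -/(packing_edges R).
  rewrite !inE !negb_or va vb wa wb uR !andbT /=.
  have nva := neq _ _ eva; have nvb := neq _ _ evb.
  have D x y : v != y -> [set v; x] != [set w; y].
    move=> nvy; apply/eqP => /setP /(_ v); rewrite !inE eqxx /= => /esym.
    by rewrite (negbTE vw) (negbTE nvy).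
  rewrite !D //= andbT; apply/andP; split.
    by apply/eqP => /set2_inj E; rewrite E eqxx in ab.
  by apply/eqP => /set2_inj E; rewrite E eqxx in ab.
move=> z; rewrite /load /=; have := lR z; rewrite /load => lz.
case: (eqVneq a z) => [Ea|_]; case: (eqVneq b z) => [Eb|_] /=.
- by rewrite Ea Eb eqxx in ab.
- by move: la; rewrite Ea /load add0n -addnA add1n.
- by move: lb; rewrite Eb /load add0n addnCA add1n.
- by rewrite !add0n.
Qed.

End Packing.

(** * Decomposition into few trails *)

Lemma two_of_count (T : eqType) (a : pred T) (D : seq T) : 1 < count a D ->
  exists t1 t2 D', [/\ perm_eq D (t1 :: t2 :: D'), a t1 & a t2].
Proof.
rewrite -size_filter => h.
have p : perm_eq (filter a D ++ filter (predC a) D) D by rewrite perm_filterC.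
case E: (filter a D) h p => [|t1 [|t2 F]] // _ p.
exists t1, t2, (F ++ filter (predC a) D); split.
- by rewrite perm_sym.
- have : t1 \in filter a D by rewrite E inE eqxx.
  by rewrite mem_filter => /andP[].
have : t2 \in filter a D by rewrite E !inE eqxx orbT.
by rewrite mem_filter => /andP[].
Qed.

Section TrailDecomposition.
Variable G : sgraph.
Implicit Types (z : G) (t : G * seq G) (D : seq (G * seq G)).

Definition is_walk t := path adj t.1 t.2.
Definition has_end z t := (t.1 == z) || (last t.1 t.2 == z).
Definition trails_edges D := flatten (map (@trail_edges G) D).

Definition reverse_trail t : G * seq G := (last t.1 t.2, rev (belast t.1 t.2)).

Lemma trail_edges_cat (u : G) s1 s2 :
  trail_edges (u, s1 ++ s2) = trail_edges (u, s1) ++ trail_edges (last u s1, s2).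
Proof. exact: pairmap_cat. Qed.

Lemma last_reverse t : last (reverse_trail t).1 (reverse_trail t).2 = t.1.
Proof. by case: t => u [|v s] //=; rewrite /= rev_cons last_rcons. Qed.

Lemma walk_reverse t : is_walk (reverse_trail t) = is_walk t.
Proof.
rewrite /is_walk /= rev_path; apply: eq_path => x y; exact: adj_sym.
Qed.

Lemma edges_reverse t : perm_eq (trail_edges (reverse_trail t)) (trail_edges t).
Proof.
case: t => u s; elim: s u => [|v s IH] u //=.
rewrite /reverse_trail /= rev_cons -cats1 trail_edges_cat /=.
have E : last (last v s) (rev (belast v s)) = v by exact: (last_reverse (v, s)).
rewrite E /trail_edges /= setUC perm_catC /= perm_cons; exact: IH.
Qed.

Lemma join_trails z t1 t2 : has_end z t1 -> has_end z t2 -> is_walk t1 -> is_walk t2 ->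
  exists2 t, is_walk t & perm_eq (trail_edges t) (trail_edges t1 ++ trail_edges t2).
Proof.
move=> e1 e2 w1 w2.
have [t1' [w1' l1 p1]] : exists t1', [/\ is_walk t1', last t1'.1 t1'.2 = z &
    perm_eq (trail_edges t1') (trail_edges t1)].
  case/orP: e1 => /eqP e1; last by exists t1.
  by exists (reverse_trail t1); rewrite walk_reverse last_reverse edges_reverse.
have [t2' [w2' l2 p2]] : exists t2', [/\ is_walk t2', t2'.1 = z &
    perm_eq (trail_edges t2') (trail_edges t2)].
  case/orP: e2 => /eqP e2; first by exists t2.
  by exists (reverse_trail t2); rewrite walk_reverse edges_reverse.
exists (t1'.1, t1'.2 ++ t2'.2).
  by rewrite /is_walk /= cat_path l1 -l2; apply/andP; split.
rewrite trail_edges_cat l1 -l2 -!surjective_pairing.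
by apply: perm_cat.
Qed.

Lemma edges_as_trails (E : seq {set G}) : {subset E <= edges G} ->
  exists2 D, all is_walk D & perm_eq (trails_edges D) E.
Proof.
elim: E => [|d E IH] sub; first by exists [::].
have [|D wD pD] := IH; first by move=> f fE; apply: sub; rewrite inE fE orbT.
have := sub d; rewrite inE eqxx inE => /(_ isT) /existsP[x /existsP[y /andP[xy /eqP->]]].
exists ((x, [:: y]) :: D); first by rewrite /= /is_walk /= xy wD.
by rewrite /trails_edges /= perm_cons.
Qed.

(** A decomposition with the least number of trails: two trails with a common
    end could be joined. *)
Lemma trail_decomposition (E : seq {set G}) : {subset E <= edges G} ->
  exists D, [/\ all is_walk D, perm_eq (trails_edges D) E &
    forall z, \sum_(t <- D) ((t.1 == z) + (last t.1 t.2 == z)) <= 2].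
Proof.
case/edges_as_trails => D.
elim: {D}(size D) {-2}D (leqnn (size D)) => [|n IH] D sD wD pD.
  by case: D sD wD pD => // _ _ p; exists [::]; split=> // z; rewrite big_nil.
case: (pselect (exists z, 1 < count (has_end z) D)) => [[z]|none].
  case/two_of_count=> t1 [t2 [D' [p e1 e2]]].
  have wD' := wD; move: wD'; rewrite (perm_all _ p) /= => /and3P[w1 w2 w'].
  have [t wt pt] := join_trails e1 e2 w1 w2.
  apply: (IH (t :: D')); first by rewrite -ltnS; apply: leq_trans sD; rewrite (perm_size p).
    by rewrite /= wt.
  apply: perm_trans pD; rewrite perm_sym.
  apply: perm_trans (perm_flatten (perm_map _ p)) _.
  by rewrite /trails_edges /= catA perm_cat2r perm_sym.
exists D; split=> // z.
have : count (has_end z) D <= 1.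
  by rewrite leqNgt; apply/negP => h; apply: none; exists z.
move=> h; apply: (@leq_trans (2 * count (has_end z) D)); last by case: (count _ _) h => [|[]].
elim: (D) => [|t D' IHD]; first by rewrite big_nil.
rewrite big_cons /= mulnDr leq_add //; rewrite /has_end.
by case: (_ == z); case: (_ == z).
Qed.

End TrailDecomposition.

(** * Two families of vertex pairs *)

Section Pairs.
Variable T : finType.
Implicit Types (z v w u : T) (X : {set T}).

Notation n := #|T|.
Definition rank v : nat := enum_rank v.

Lemma card_rank (P : pred nat) : #|[set v | P (rank v)]| = count P (iota 0 n).
Proof.
transitivity #|[set i : 'I_n | P i]|.
  rewrite -(on_card_preimset (f := enum_rank)) //; last exact: onW_bij (enum_rank_bij T).
  by apply: eq_card => v; rewrite !inE.
by rewrite cardsE -val_enum_ord count_map -sum1_count big_enum_cond /= sum1_card.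
Qed.

(** ** Pairs at bounded cyclic distance *)

Definition shift j v : T := nth v (enum T) ((rank v + j) %% n).
(** The first entries serve as base points. Shifts give every base point [k] different
    partners without making any vertex a partner too often. *)
Definition cyclic_pairs k := [seq (v, shift j v) | v <- enum T, j <- iota 1 k].

Lemma rank_shift j v : rank (shift j v) = (rank v + j) %% n.
Proof.
have lt : (rank v + j) %% n < n by rewrite ltn_mod; apply/card_gt0P; exists v.
rewrite /shift (_ : nth _ _ _ = enum_val (Ordinal lt)); last first.
  by apply: set_nth_default; rewrite -cardE.
by rewrite /rank enum_valK.
Qed.

Lemma shift_neq j v : 0 < j < n -> shift j v != v.
Proof.
move=> /andP[j0 jn]; apply/eqP => /(congr1 rank); rewrite rank_shift.
have := ltn_ord (enum_rank v); rewrite -/(rank v) => lt E.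
case: (ltnP (rank v + j) n) => h.
  by rewrite modn_small // in E; lia.
have E2 : (rank v + j) %% n = rank v + j - n.
  by rewrite -{1}(subnK h) modnDr modn_small //; lia.
lia.
Qed.

Lemma shift_inj j : injective (shift j).
Proof.
move=> v w /(congr1 rank); rewrite !rank_shift => /eqP; rewrite eqn_modDr.
by rewrite !modn_small ?ltn_ord // => /eqP /val_inj /enum_rank_inj.
Qed.

Lemma shift_index_inj v j j' : j <= n -> 0 < j -> j' <= n -> 0 < j' -> shift j v = shift j' v -> j = j'.
Proof.
move=> jn j0 jn' j0' /(congr1 rank); rewrite !rank_shift => /eqP; rewrite eqn_modDl.
case: (ltngtP j n) jn => [jn _|//|-> _]; case: (ltngtP j' n) jn' => [jn' _|//|-> _];
rewrite ?modnn ?modn_small //.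
- by move/eqP.
- by move/eqP; lia.
- by move/eqP; lia.
Qed.

Lemma uniq_cyclic_pairs k : k <= n -> uniq (cyclic_pairs k).
Proof.
move=> kn; apply: allpairs_uniq_dep; rewrite ?enum_uniq //.
  by move=> v _; apply: iota_uniq.
move=> [v j] [v' j'] /allpairsPdep[v1 [j1 [_ + [-> ->]]]] /allpairsPdep[v2 [j2 [_ + [-> ->]]]].
rewrite !mem_iota /= => b1 b2 [Ev]; rewrite -Ev => E.
by rewrite (shift_index_inj _ _ _ _ E) //; lia.
Qed.

Lemma count_allpairs (A B C : eqType) (f : A -> B -> C) (P : pred C) s t :
  count P [seq f x y | x <- s, y <- t] = \sum_(x <- s) \sum_(y <- t) P (f x y).
Proof. by rewrite -sum1_count big_mkcond big_allpairs_dep /=. Qed.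

Lemma count_base_cyclic_pairs k v :
  count (fun p : T * T => p.1 == v) (cyclic_pairs k) = k.
Proof.
rewrite count_allpairs /= (bigD1_seq v) ?mem_enum ?enum_uniq //=.
rewrite eqxx [X in _ + X]big1_seq => [|i /andP[/= ni _]].
  by rewrite addn0 big_const_seq count_predT size_iota iter_addn_0 mul1n.
by rewrite big1 // (negbTE ni).
Qed.

Lemma load_cyclic_pairs k z : load z (cyclic_pairs k) <= k + k.
Proof.
rewrite /load !count_map leq_add //; first by rewrite count_base_cyclic_pairs.
rewrite count_allpairs exchange_big /= -[X in _ <= X](size_iota 1 k) -sum1_size.
apply: leq_sum => j _; case: (pickP (fun v => shift j v == z)) => [v /eqP Ev|none].
  rewrite (bigD1_seq v) ?mem_enum ?enum_uniq //= Ev eqxx big1_seq // => i /andP[+ _].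
  by rewrite -(inj_eq (@shift_inj j) i v) Ev => /negbTE->.
by rewrite big1 // => v _; rewrite none.
Qed.

Lemma cyclic_pairs_neq k : k < n -> all (fun c : T * T => c.1 != c.2) (cyclic_pairs k).
Proof.
move=> kn; apply/allP => c /allpairsP[[v j] [_ + ->]] /=.
rewrite mem_iota eq_sym => /andP[j0 jk]; apply: shift_neq.
by rewrite j0 (leq_trans _ kn).
Qed.

Lemma size_cyclic_pairs k : size (cyclic_pairs k) = n * k.
Proof. by rewrite size_allpairs size_iota -cardT. Qed.

(** ** Pairs separated by every balanced bipartition *)

Variables (q l : nat).
Hypotheses (q_gt0 : 0 < q) (ql_le : q * l <= n).

(** All hubs are linked to each other, but another vertex is only linked to the [l] hubs
    in its residue class; linking it to all hubs would overload them. *)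
Definition hub u := rank u < q * l.
Definition linked (i u : T) := [&& i != u, hub u & hub i || (rank i == rank u %[mod q])].
Definition hub_pairs : seq (T * T) := [seq p <- enum {: T * T} | linked p.1 p.2].

Lemma hub_pairs_neq : all (fun c : T * T => c.1 != c.2) hub_pairs.
Proof. by apply/allP => c; rewrite mem_filter => /andP[/and3P[]]. Qed.

Lemma count_hub_pairs (P : pred (T * T)) :
  count P hub_pairs = #|[set p | linked p.1 p.2 && P p]|.
Proof.
rewrite cardsE /hub_pairs -sum1_count big_filter_cond big_enum_cond /= sum1_card.
by apply: eq_card.
Qed.

Lemma count_lt m k : count (fun i => i < m) (iota 0 k) <= m.
Proof.
rewrite -size_filter -[X in _ <= X](size_iota 0).
apply: uniq_leq_size; first by rewrite filter_uniq ?iota_uniq.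
by move=> i; rewrite mem_filter !mem_iota => /andP[->].
Qed.

Lemma count_residue c m : c < q -> count (fun i => i %% q == c) (iota 0 (q * m)) = m.
Proof.
move=> cq; elim: m => [|m IH]; first by rewrite muln0.
rewrite mulnSr iotaD count_cat IH add0n -addn1; congr (_ + _).
rewrite -[q * m]addn0 iotaDl count_map.
transitivity (count_mem c (iota 0 q)); last by rewrite count_uniq_mem ?iota_uniq // mem_iota add0n cq.
apply: eq_in_count => i; rewrite mem_iota /= add0n => iq.
by rewrite mulnC modnMDl modn_small.
Qed.

Lemma card_hub : #|[set u | hub u]| <= q * l.
Proof. by rewrite (card_rank (fun i => i < q * l)) count_lt. Qed.

Lemma card_residue z : #|[set i | rank i == rank z %[mod q]]| <= n %/ q + 1.
Proof.
rewrite (card_rank (fun i => i %% q == rank z %% q)).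
rewrite -[X in _ <= X](@count_residue (rank z %% q)) ?ltn_mod //.
have le : n <= q * (n %/ q + 1) by rewrite addn1 mulnC ltnW // ltn_ceil.
by rewrite -(subnKC le) iotaD count_cat leq_addr.
Qed.

Lemma card_hub_residue c : c < q -> #|[set u | hub u && (rank u %% q == c)]| = l.
Proof.
move=> cq; rewrite (card_rank (fun i => (i < q * l) && (i %% q == c))).
rewrite -{1}(subnKC ql_le) iotaD count_cat -[RHS](@count_residue c) // -[RHS]addn0.
congr (_ + _).
  by apply: eq_in_count => i; rewrite mem_iota add0n => /andP[_ ->].
rewrite add0n; apply/eqP; rewrite eqn0Ngt -has_count; apply/hasPn => i.
by rewrite mem_iota => /andP[h _]; rewrite ltnNge h.
Qed.

Lemma load_hub_pairs z : load z hub_pairs <= 2 * (q * l) + n %/ q + 1.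
Proof.
have A : count_mem z (map fst hub_pairs) <= q * l.
  rewrite count_map count_hub_pairs; apply: leq_trans card_hub.
  rewrite -(card_imset _ (fun u v (E : (z, u) = (z, v)) => congr1 snd E)).
  apply: subset_leq_card; apply/subsetP => -[i u]; rewrite inE /= => /andP[/and3P[_ hu _] /eqP->].
  by apply/imsetP; exists u; rewrite ?inE.
have B : count_mem z (map snd hub_pairs) <= q * l + (n %/ q + 1).
  rewrite count_map count_hub_pairs; apply: leq_trans (leq_add card_hub (card_residue z)).
  apply: leq_trans _ (leq_card_setU _ _).
  rewrite -(card_imset _ (fun u v (E : (u, z) = (v, z)) => congr1 fst E)).
  apply: subset_leq_card; apply/subsetP => -[i u]; rewrite inE /= => /andP[/and3P[_ _ hi] /eqP Eu].
  by apply/imsetP; exists i; rewrite ?Eu // !inE -Eu.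
rewrite /load; lia.
Qed.

Definition separates X : pred (T * T) := fun p => (p.1 \in X) != (p.2 \in X).

Lemma separates_setC X : separates (~: X) =1 separates X.
Proof. by move=> p; rewrite /separates !inE; case: (_ \in X); case: (_ \in X). Qed.

(** Each vertex of [X] shares its residue class with [l] hubs, and fewer than half of
    these are in [X]. *)
Lemma few_hubs_separated X : l <= #|X| -> 2 * #|[set u | hub u] :&: X| < l ->
  l * l <= 4 * count (separates X) hub_pairs.
Proof.
move=> lX few; rewrite count_hub_pairs.
set S := [set p | _]; set u1 := #|_| in few.
suff h : #|X| * (l - u1) <= #|S|.
  by have : l * (2 * (l - u1)) <= 2 * #|S|; [nia|]; nia.
pose N (i : T) := [set u | linked i u && (u \notin X)].
have NE i : i \in X -> l - u1 <= #|N i|.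
  move=> iX; rewrite -(@card_hub_residue (rank i %% q)) ?ltn_mod //.
  rewrite leq_subLR -(cardsID X [set u | hub u && _]) leq_add //; apply: subset_leq_card.
    by apply/subsetP => u; rewrite !inE => /andP[/andP[-> _] ->].
  apply/subsetP => u; rewrite !inE /linked => /andP[nX /andP[-> /eqP->]].
  by rewrite nX eqxx orbT !andbT; apply: contraNneq nX => <-.
apply: (@leq_trans (\sum_(i in X) #|N i|)); first by rewrite -sum_nat_const leq_sum.
under eq_bigr do rewrite -sum1_card.
rewrite pair_big_dep /= sum1_card; apply: subset_leq_card; apply/subsetP => p.
by rewrite unfold_in /= !inE /separates => /and3P[-> -> /negbTE->].
Qed.

(** A bipartition with two parts of size at least [l] separates many pairs: either it
    cuts the hubs, all of which are linked to each other, evenly enough, or one part has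
    most of the hubs, and the vertices of the other part are linked to many of these. *)
Lemma separated_hub_pairs X : l <= #|X| -> l <= #|~: X| ->
  l * l <= 4 * count (separates X) hub_pairs.
Proof.
move=> lX lC; set U := [set u | hub u].
case: (ltnP (2 * #|U :&: X|) l) => [|h1]; first exact: few_hubs_separated.
case: (ltnP (2 * #|U :&: ~: X|) l) => [|h2].
  by move/(few_hubs_separated lC); rewrite (eq_count (separates_setC X)).
suff : #|U :&: X| * #|U :&: ~: X| <= count (separates X) hub_pairs by nia.
rewrite -cardsX count_hub_pairs; apply: subset_leq_card; apply/subsetP => -[i u].
rewrite !inE /= => /andP[/andP[hi iX] /andP[hu uX]].
rewrite /linked hi hu /separates /= iX (negbTE uX) !andbT.
by apply: contraNneq uX => <-.
Qed.

End Pairs.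

(** * Components and subtrees *)

Lemma connect_invariant (T : finType) (e : rel T) (A : pred T) x y :
  (forall u v, e u v -> A u -> A v) -> connect e x y -> A x -> A y.
Proof.
move=> cl /connectP[p + ->]; elim: p x => //= z p IH x /andP[xz pz] Ax.
by apply: IH pz _; apply: cl Ax.
Qed.

(** Unions of components of [e], when [e] is symmetric. *)
Definition two_sided (T : finType) (e : rel T) (X : {set T}) :=
  [forall x, forall y, e x y ==> ((x \in X) == (y \in X))].

Lemma two_sidedP (T : finType) (e : rel T) (X : {set T}) :
  reflect (forall x y, e x y -> (x \in X) = (y \in X)) (two_sided e X).
Proof.
apply: (iffP forallP) => [h x y exy|h x].
  by move: (h x) => /forallP /(_ y); rewrite exy => /eqP.
by apply/forallP => y; apply/implyP => /h ->.
Qed.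

(** Take a smallest union of components with more than [r] vertices: if it leaves too
    few vertices outside, then it is a single component. *)
Lemma giant_or_balanced (T : finType) (e : rel T) r : symmetric e -> 3 * r < #|T| ->
  (exists v, #|T| - r <= #|[set w | connect e v w]|) \/
  (exists X : {set T}, [/\ two_sided e X, r < #|X| & r < #|~: X|]).
Proof.
move=> esym rn; pose P (X : {set T}) := two_sided e X && (r < #|X|).
have PT : P setT.
  by rewrite /P cardsT; apply/andP; split; [apply/two_sidedP => x y; rewrite !inE | lia].
have cs := sym_connect_sym esym.
have tsc v : two_sided e [set w | connect e v w].
  apply/two_sidedP => x y exy; rewrite !inE.
  exact: (same_connect_r cs (connect1 exy)).
case: (arg_minnP (fun X : {set T} => #|X|) PT) => X /andP[clX rX] minX.
case: (ltnP r #|~: X|) => h; first by right; exists X.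
have cX := cardsC X.
have [v vX] : exists v, v \in X by apply/card_gt0P; lia.
pose C := [set w | connect e v w].
case: (leqP (#|T| - r) #|C|) => hC; first by left; exists v.
have cC := cardsC C.
case: (ltnP r #|C|) => h2; first by right; exists C; split; [exact: tsc | | lia].
have CX : C \subset X.
  apply/subsetP => w; rewrite inE => vw.
  apply: (connect_invariant (A := mem X)) vw vX => a b ab.
  by rewrite /= (two_sidedP _ _ clX a b ab).
have PD : P (X :\: C).
  rewrite /P cardsD (setIidPr CX); apply/andP; split; last by lia.
  apply/two_sidedP => a b ab; rewrite !inE.
  have := two_sidedP _ _ (tsc v) a b ab; rewrite !inE => ->.
  by rewrite (two_sidedP _ _ clX a b ab).
have := minX _ PD; rewrite cardsD (setIidPr CX).
have : 0 < #|C| by apply/card_gt0P; exists v; rewrite inE connect0.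
lia.
Qed.

Section Trees.
Variable G : sgraph.
Implicit Types (H : presubgraph G) (x y z : G) (c : seq G).

Lemma edgesP (d : {set G}) : reflect (exists x y, adj x y /\ d = [set x; y]) (d \in edges G).
Proof.
rewrite inE; apply: (iffP existsP) => [[x /existsP[y /andP[xy /eqP->]]]|[x [y [xy ->]]]].
  by exists x, y.
by exists x; apply/existsP; exists y; rewrite xy eqxx.
Qed.

Lemma edge_adj x y : ([set x; y] \in edges G) = adj x y.
Proof.
apply/edgesP/idP => [[u [v [uv E]]]|xy]; last by exists x, y.
have nuv := adj_neq uv.
have xE : x \in [set u; v] by rewrite -E set21.
have yE : y \in [set u; v] by rewrite -E set22.
have uE : u \in [set x; y] by rewrite E set21.
have vE : v \in [set x; y] by rewrite E set22.
move: xE yE uE vE; rewrite !inE.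
case/orP=> /eqP-> /orP[]/eqP-> //; rewrite ?eqxx ?orbT //= ?orbb.
- by move=> _ /eqP E'; rewrite E' eqxx in nuv.
- by rewrite adj_sym.
by move/eqP=> E'; rewrite E' eqxx in nuv.
Qed.

(** The adjacency of [graph_of H] as a relation on [G], so that the vertex type stays the
    same while a tree grows. *)
Definition adj_in H : rel G := fun x y =>
  [&& x \in H.1, y \in H.1, x != y & [set x; y] \in H.2].

Lemma adj_in_sym H : symmetric (adj_in H).
Proof. by move=> x y; rewrite /adj_in eq_sym setUC; case: (x \in _); case: (y \in _). Qed.

Lemma sub_adjE H : @sub_adj G H =2 relpre val (adj_in H).
Proof. by move=> x y; rewrite /sub_adj /adj_in /= (valP x) (valP y). Qed.

Lemma lift_path H (x : {x | x \in H.1}) p : path (adj_in H) (val x) p ->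
  exists2 p' : seq {x | x \in H.1}, p = map val p' & path (@sub_adj G H) x p'.
Proof.
elim: p x => [|y p IH] x /=; first by exists [::].
case/andP=> xy py; have yH : y \in H.1 by case/and4P: xy.
have [p' -> pp] := IH (exist _ y yH) py.
by exists (exist _ y yH :: p') => //=; rewrite pp andbT sub_adjE.
Qed.

Lemma graph_of_tree H x0 : x0 \in H.1 ->
  {in H.1 &, forall x y, connect (adj_in H) x y} ->
  (forall c, ucycle (adj_in H) c -> size c < 3) -> is_tree (graph_of H).
Proof.
move=> x0H conn acyc; split.
- by apply/card_gt0P; exists (exist _ x0 x0H).
- move=> x y; have /connectP[p px E] := conn _ _ (valP x) (valP y).
  have [p' Ep pp] := lift_path px.
  apply/connectP; exists p' => //; apply: val_inj; rewrite E Ep.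
  by rewrite last_map.
move=> c /andP[cc uc]; rewrite -(size_map val); apply: acyc.
rewrite /ucycle map_inj_uniq; last exact: val_inj.
rewrite uc andbT; case: c cc {uc} => // x p; rewrite /= -map_rcons.
by rewrite path_map; apply: sub_path => a b; rewrite -sub_adjE.
Qed.

(** Growing a tree: adding a pendant edge keeps it connected and creates no cycle. *)
Lemma grow_subtree (E : {set {set G}}) v t : E \subset edges G -> 0 < t ->
  t <= #|[set w | connect (fun x y => [set x; y] \in E) v w]| ->
  exists H, is_subtree t H /\ H.2 \subset E.
Proof.
move=> EG; set C := [set w | _].
suff : 0 < t -> t <= #|C| -> exists H, [/\ H.2 \subset E,
    (forall e, e \in H.2 -> e \subset H.1), v \in H.1, #|H.1| = t &
    {in H.1 &, forall x y, connect (adj_in H) x y} /\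
    (forall c, ucycle (adj_in H) c -> size c < 3)].
  move=> h t0 tC; have [H [HE sH vH cH [conn acyc]]] := h t0 tC.
  exists H; split=> //; split=> //; last exact: graph_of_tree vH conn acyc.
  by split=> //; apply: subset_trans EG.
elim: t => // t IH _ tC; case: (posnP t) => [t0|t0].
  exists ([set v], set0); rewrite /= t0 cards1 sub0set set11; split=> //.
    by move=> d; rewrite inE.
  split; first by move=> x y /set1P-> /set1P->; apply: connect0.
  by case=> // x [|y c] //=; rewrite /ucycle /= /adj_in /= !inE !andbF.
have [H [HE sH vH cH [conn acyc]]] := IH t0 (ltnW tC).
have [x [y [xH yH xyE]]] : exists x y, [/\ x \in H.1, y \notin H.1 & [set x; y] \in E].
  apply: contrapT => none.
  have : C \subset H.1.
    apply/subsetP => w; rewrite inE => vw.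
    apply: (connect_invariant (A := mem H.1)) vw vH => a b ab aH.
    by apply: contrapT => /negP bH; apply: none; exists a, b.
  by move/subset_leq_card; rewrite cH leqNgt tC.
have yx : y != x by apply: contraNneq yH => ->.
pose H' : presubgraph G := (y |: H.1, [set x; y] |: H.2).
have sub u w : adj_in H u w -> adj_in H' u w.
  by case/and4P=> uH wH uw uwH; rewrite /adj_in /= !inE uH wH uw uwH !orbT.
have csub u w : connect (adj_in H) u w -> connect (adj_in H') u w.
  exact: (connect_sub (fun a b ab => connect1 (sub a b ab))).
have xy' : adj_in H' x y by rewrite /adj_in /= !inE xH eqxx eq_sym yx eqxx !orbT.
have pend w : adj_in H' y w -> w = x.
  case/and4P=> _ _ yw; rewrite !inE => /orP[/eqP E'|/sH /subsetP/(_ y)].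
    have : w \in [set x; y] by rewrite -E' set22.
    by rewrite !inE => /orP[/eqP|/eqP Ew] //; rewrite Ew eqxx in yw.
  by rewrite set21 (negbTE yH) => /(_ isT).
exists H'; split.
- by rewrite /= subUset sub1set xyE.
- move=> d; rewrite /= !inE => /orP[/eqP->|/sH dH].
    by rewrite subUset !sub1set !inE xH eqxx orbT.
  by apply: subset_trans dH _; apply: subsetUr.
- by rewrite /= inE vH orbT.
- by rewrite /= cardsU1 yH cH.
split.
  have cs := sym_connect_sym (@adj_in_sym H').
  have cx u : u \in H'.1 -> connect (adj_in H') x u.
    rewrite /= !inE => /orP[/eqP->|uH]; first exact: connect1.
    by apply: csub; apply: conn.
  by move=> u w /cx + /cx; rewrite cs; apply: connect_trans.
move=> c /andP[cc uc]; case: (boolP (y \in c)) => yc; last first.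
  apply: acyc; rewrite /ucycle uc andbT.
  apply: (@sub_in_cycle _ (mem c) (adj_in H') _ _ _ _ cc); last exact/allP.
  move=> u w uc' wc'.
  have nu : u != y by apply: contraNneq yc => <-.
  have nw : w != y by apply: contraNneq yc => <-.
  case/and4P; rewrite /= !inE (negbTE nu) (negbTE nw) /= => uH wH uw.
  case/orP=> [/eqP E'|uwH]; last by rewrite /adj_in uH wH uw.
  have : y \in [set u; w] by rewrite E' set22.
  by rewrite !inE ![y == _]eq_sym (negbTE nu) (negbTE nw).
(* A cycle through [y] would need two different neighbours of [y]. *)
have [i p Ep] := rot_to yc.
rewrite -(size_rot i) Ep; move: cc uc; rewrite -(rot_cycle i) -(rot_uniq i) Ep.
case: p {Ep} => [|z p] //=; rewrite rcons_path => /andP[/pend Ez /andP[_ lz]].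
case/and3P=> _ + _; rewrite adj_in_sym in lz; move/pend: lz; rewrite -Ez.
by case/lastP: p => // p w; rewrite last_rcons => ->; rewrite mem_rcons inE eqxx.
Qed.

End Trees.

(** * Cuts and colourings *)

Section Bounds.
Variable G : sgraph.
Implicit Types (H : presubgraph G) (x y z : G) (X : {set G}).

Definition boundary X : {set {set G}} :=
  [set e in edges G | [exists x in X, exists y in ~: X, e == [set x; y]]].

Lemma in_boundary X x y : adj x y ->
  ([set x; y] \in boundary X) = ((x \in X) != (y \in X)).
Proof.
move=> xy; rewrite inE edge_adj xy /=; apply/exists_inP/idP.
  case=> u uX /exists_inP[v]; rewrite inE => vX /eqP E.
  have uE : u \in [set x; y] by rewrite E set21.
  have vE : v \in [set x; y] by rewrite E set22.
  move: uE vE uX vX; rewrite !inE.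
  by case/orP=> /eqP-> /orP[]/eqP-> => [|||]; case: (_ \in X); case: (_ \in X).
case: (boolP (x \in X)) => xX; case: (boolP (y \in X)) => yX // _.
  by exists x => //; apply/exists_inP; exists y; rewrite // inE.
by exists y => //; apply/exists_inP; exists x; rewrite ?inE // setUC.
Qed.

Lemma boundary_edges X : boundary X \subset edges G.
Proof. by apply/subsetP => e; rewrite inE => /andP[]. Qed.

Lemma subtree_crosses t H X x y : is_subtree t H -> x \in H.1 -> y \in H.1 ->
  x \in X -> y \notin X -> exists2 d, d \in boundary X & d \in H.2.
Proof.
case=> -[HG sH] [_ conn _] _ xH yH xX yX; apply: contrapT => none.
have := conn (exist _ x xH) (exist _ y yH).
move/(connect_invariant (A := fun u => val u \in X)) => h.
move/negP: yX; apply; apply: h xX => -[u uH] [v vH] /= /andP[uv uvH] uX.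
apply: contrapT => /negP vX; apply: none; exists [set u; v] => //.
by rewrite in_boundary ?uX ?(negbTE vX) // -edge_adj (subsetP HG).
Qed.

Lemma subtree_edge t H : 1 < t -> is_subtree t H -> exists d, d \in H.2.
Proof.
move=> t1 tH; have [_ _ cH] := tH; move: t1; rewrite -cH => /card_gt1P[x [y [xH yH xy]]].
have [||d _ dH] := subtree_crosses (X := [set x]) tH xH yH; last by exists d.
  exact: set11.
by rewrite inE eq_sym.
Qed.

(** Colouring every tree by one of its edges in [B] is proper, as the trees of one
    colour share that edge. *)
Lemma colorable_by_transversal t (B : {set {set G}}) :
  (forall H, is_subtree t H -> exists2 d, d \in B & d \in H.2) ->
  colorable (tree_graph G t) #|B|.
Proof.
move=> tr; pose g (S : subtree G t) := odflt set0 [pick d in B :&: (val S).2].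
have gP S : g S \in B /\ g S \in (val S).2.
  rewrite /g; case: pickP => [d|none] /=; first by rewrite inE => /andP[].
  have /asboolP/tr[d dB dS] := valP S.
  by have := none d; rewrite inE dB dS.
have lt S : index (g S) (enum B) < #|B|.
  by rewrite cardE index_mem mem_enum; case: (gP S).
apply/existsP; exists [ffun S : tree_graph G t => Ordinal (lt S)].
apply/forallP => S; apply/forallP => T; apply/implyP => /andP[_ dST].
rewrite !ffunE; apply/eqP => /(congr1 val) /= E.
have {}E : g S = g T.
  have [gS _] := gP S; have [gT _] := gP T.
  by rewrite -(nth_index set0 (_ : g S \in enum B)) ?mem_enum // E nth_index ?mem_enum.
move/pred0P: dST => /(_ (g S)) /=; have [_ ->] := gP S.
by rewrite E; have [_ ->] := gP T.
Qed.

Lemma chromatic_le k (K : sgraph) : colorable K k -> chromatic_number K <= k.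
Proof. by rewrite /chromatic_number; case: ex_minnP => m _ h /h. Qed.

Lemma bigmin_attained (I : finType) (P : pred I) (F : I -> nat) d :
  \big[minn/d]_(i | P i) F i = d \/
  exists2 i, P i & \big[minn/d]_(i | P i) F i = F i.
Proof.
elim/big_ind: _ => [|m k hm hk|i Pi]; [by left | | by right; exists i].
by rewrite /minn; case: ifP.
Qed.

Lemma bigmin_le (I : finType) (P : pred I) (F : I -> nat) d i : P i ->
  \big[minn/d]_(j | P j) F j <= F i.
Proof.
move=> Pi; elim: (index_enum I) (mem_index_enum i) => // j s IH.
rewrite inE big_cons; case/predU1P=> [<-|/IH le]; first by rewrite Pi geq_minl.
by case: ifP => // _; apply: leq_trans (geq_minr _ _) le.
Qed.

Lemma cut_number_le s X : is_scut s X -> cut_number G s <= cut_size X.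
Proof. exact: bigmin_le. Qed.

Lemma cut_number_le_edges s : cut_number G s <= #|edges G|.
Proof.
rewrite /cut_number; elim/big_ind: _ => // [m k hm _|X _].
  by apply: leq_trans (geq_minl _ _) hm.
exact: subset_leq_card (boundary_edges X).
Qed.

Lemma chromatic_le_cut_number r : r.+1 < #|G| ->
  chromatic_number (tree_graph G (#|G| - r)) <= cut_number G r.+1.
Proof.
move=> rG; apply: chromatic_le.
rewrite /cut_number; case: (bigmin_attained (is_scut r.+1) (@cut_size G) #|edges G|).
  move=> ->; apply: colorable_by_transversal => H tH.
  have [|d dH] := subtree_edge _ tH; first by lia.
  by exists d => //; case: tH => -[/subsetP HG _] _ _; apply: HG.
case=> X /andP[_ sX] ->; apply: (@colorable_by_transversal _ (boundary X)) => H tH.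
have [_ _ cH] := tH; move: sX; rewrite leq_min => /andP[sX sY].
have meet (Y : {set G}) : r < #|Y| -> exists2 x, x \in H.1 & x \in Y.
  move=> rY; have : 0 < #|H.1 :&: Y|.
    have UI := cardsUI H.1 Y; have U : #|H.1 :|: Y| <= #|G| by apply: max_card.
    rewrite lt0n; apply/eqP => I0; move: UI U; rewrite I0 addn0 cH => ->.
    by lia.
  by case/card_gt0P=> x; rewrite inE => /andP[]; exists x.
have [x xH xX] := meet _ sX; have [y yH] := meet _ sY; rewrite inE => yX.
exact: subtree_crosses tH xH yH xX yX.
Qed.

(** A large component of one sign contains a tree of that sign, so the alternation bound
    applies to trees as soon as the edges are suitably ordered. *)
Lemma cut_number_le_chromatic r (L : seq {set G}) : r.+1 < #|G| ->
  perm_eq L (enum (edges G)) ->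
  (forall x : {set G} -> option bool,
     #|edges G| - cut_number G r.+1 < alt (map x L) ->
     exists b v, #|G| - r <= #|[set w | connect
        (fun y z => [set y; z] \in [set d in edges G | x d == Some b]) v w]|) ->
  cut_number G r.+1 <= chromatic_number (tree_graph G (#|G| - r)).
Proof.
move=> rG pL big; set t := #|G| - r.
have t1 : 1 < t by rewrite /t; lia.
rewrite /chromatic_number; case: ex_minnP => k /existsP[f /forallP fP] _.
have uL : uniq L by rewrite (perm_uniq pL) enum_uniq.
have sL : size L = #|edges G| by rewrite (perm_size pL) -cardE.
have := @kneser_alternation_bound _ (subtree G t) L (fun S => (val S).2) k
  (#|edges G| - cut_number G r.+1) f uL.
rewrite sL => h; have := cut_number_le_edges r.+1.
suff : #|edges G| <= #|edges G| - cut_number G r.+1 + k by lia.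
apply: h => [S T dST|x /big[b [v hv]]].
  move: (fP S) => /forallP /(_ T) /implyP; apply; apply/andP; split=> //.
  have /asboolP/(subtree_edge t1)[d dS] := valP S.
  apply: contraTneq dST => <-; apply/pred0Pn; exists d.
  by rewrite /= dS.
have [||H [tH HE]] := grow_subtree (t := t) _ _ hv.
- by apply/subsetP => d; rewrite inE => /andP[].
- by rewrite ltnW.
have tH' : `[< is_subtree t H >] by apply/asboolP.
exists (exist _ H tH'), b => e /= /(subsetP HE); rewrite inE.
by case/andP=> _ /eqP.
Qed.

End Bounds.

(** * The ordering of the edges and its deficit *)

Lemma perm_classes (A : eqType) (B : finType) (f : A -> B) (s : seq A) :
  perm_eq s (flatten [seq [seq a <- s | f a == b] | b <- enum B]).
Proof.
apply/permP => P; rewrite count_flatten sumnE !big_map.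
elim: s => [|a s IH] /=; first by rewrite big1.
rewrite IH -!enumT (bigD1_seq (f a)) ?mem_enum ?enum_uniq //=.
rewrite [in RHS](bigD1_seq (f a)) ?mem_enum ?enum_uniq //= eqxx /= -addnA.
congr (_ + (_ + _)); apply: eq_bigr => b nb.
by rewrite eq_sym (negbTE nb).
Qed.

Lemma count_sum (A : Type) (P : pred A) s : count P s = \sum_(a <- s) P a.
Proof. by elim: s => [|a s IH]; rewrite ?big_nil ?big_cons //= IH. Qed.

Section Ordering.
Variables (G : sgraph) (h m2 : nat) (R2 R1 : seq (quad G)) (D : seq (G * seq G)).
Hypotheses (R2_quads : all (is_quad (@adj G)) R2) (R1_quads : all (is_quad (@adj G)) R1).
Hypothesis R1_base : map fst R1 = cyclic_pairs G (2 * h).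
Hypothesis h_small : 2 * h <= #|G|.
Hypothesis R2_degree : forall z,
  count (fun d : {set G} => z \in d) (packing_edges R2) <= 2 * m2.
Hypothesis D_walks : all (@is_walk G) D.
Hypothesis D_ends : forall z, \sum_(t <- D) ((t.1 == z) + (last t.1 t.2 == z)) <= 2.
Hypothesis pieces :
  perm_eq (packing_edges R2 ++ packing_edges R1 ++ trails_edges D) (enum (edges G)).

(** Four-cycles with a common base point are traversed two by two as closed walks of
    length eight. *)
Fixpoint double_squares (R : seq (quad G)) : seq (G * seq G) :=
  match R with
  | q1 :: q2 :: R' =>
      double_square q1.1.1 q1.2.1 q1.1.2 q1.2.2 q2.2.1 q2.1.2 q2.2.2 :: double_squares R'
  | _ => [::]
  end.

Definition based (v : G) := [seq q <- R1 | q.1.1 == v].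
Definition squares := flatten [seq double_squares (based v) | v <- enum G].
Definition edge_order := packing_edges R2 ++ trails_edges squares ++ trails_edges D.

Lemma size_based v : size (based v) = 2 * h.
Proof.
rewrite size_filter -(count_base_cyclic_pairs (2 * h) v) -R1_base count_map.
by [].
Qed.

Lemma ind2 (T : Type) (P : seq T -> Prop) : P [::] ->
  (forall a b s, P s -> P (a :: b :: s)) -> forall s, ~~ odd (size s) -> P s.
Proof.
move=> P0 P2 s; elim: {s}(size s) {-2}s (leqnn (size s)) => [|n IH] [|a [|b s]] //= ss.
by rewrite negbK => o; apply: P2; apply: IH => //; apply: ltnW.
Qed.

Lemma even_based v : ~~ odd (size (based v)).
Proof. by rewrite size_based oddM. Qed.

Lemma quad_edges_square (q : quad G) :
  perm_eq [:: [set q.1.1; q.2.1]; [set q.2.1; q.1.2]; [set q.1.2; q.2.2]; [set q.2.2; q.1.1]]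
    (quad_edges q).
Proof.
rewrite /quad_edges perm_cons (setUC [set q.2.1]) (setUC [set q.2.2]).
by rewrite (perm_catCA [:: _; _] [:: _] [::]).
Qed.

Lemma perm_double_squares v (R : seq (quad G)) : ~~ odd (size R) ->
  all (fun q : quad G => q.1.1 == v) R ->
  perm_eq (trails_edges (double_squares R)) (packing_edges R).
Proof.
move: R; apply: ind2 => // q1 q2 R IH /= /and3P[/eqP e1 /eqP e2 al].
pose sq (q : quad G) := [:: [set q.1.1; q.2.1]; [set q.2.1; q.1.2]; [set q.1.2; q.2.2]; [set q.2.2; q.1.1]].
have -> : trails_edges (double_squares [:: q1, q2 & R]) =
    sq q1 ++ sq q2 ++ trails_edges (double_squares R).
  by rewrite /trails_edges /sq /= e1 e2.
exact: perm_cat (quad_edges_square q1) (perm_cat (quad_edges_square q2) (IH al)).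
Qed.

Lemma perm_squares : perm_eq (trails_edges squares) (packing_edges R1).
Proof.
have p := perm_classes (fun q : quad G => q.1.1) R1.
apply: perm_trans _ (perm_flatten (perm_map _ _)); last by rewrite perm_sym; exact: p.
rewrite /squares; elim: (enum G) => //= v s IH.
rewrite /trails_edges !map_cat !flatten_cat; apply: perm_cat => //.
by apply: (@perm_double_squares v); [exact: even_based | exact: filter_all].
Qed.

Lemma perm_edge_order : perm_eq edge_order (enum (edges G)).
Proof.
apply: perm_trans pieces; rewrite /edge_order perm_cat2l perm_cat2r.
exact: perm_squares.
Qed.

Lemma double_squares_walk v (R : seq (quad G)) : ~~ odd (size R) ->
  all (fun q : quad G => q.1.1 == v) R -> all (is_quad (@adj G)) R ->
  all (fun t => [&& is_walk t, t.1 == v & last t.1 t.2 == v]) (double_squares R).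
Proof.
move: R; apply: ind2 => // q1 q2 R IH /= /and3P[/eqP e1 /eqP e2 al].
case/and3P=> /and4P[a1 a2 a3 a4] /and4P[b1 b2 b3 b4] qR.
rewrite IH // /is_walk /= e1 eqxx !andbT; move: a1 a2 b1 b2; rewrite e1 e2.
move=> -> a2 -> b2; rewrite a4 b4 ![adj _ v]adj_sym a2 b2 ![adj _ q1.1.2]adj_sym a3.
by rewrite ![adj _ q2.1.2]adj_sym b3.
Qed.

Lemma squares_based v : all (fun t => [&& is_walk t, t.1 == v & last t.1 t.2 == v])
  (double_squares (based v)).
Proof.
apply: double_squares_walk; [exact: even_based | exact: filter_all |].
by apply/allP => q; rewrite mem_filter => /andP[_]; apply/allP.
Qed.

Lemma squares_walk : all (@is_walk G) squares.
Proof.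
apply/allP => t /flatten_mapP[v _]; move: t; apply/allP.
by apply: sub_all (squares_based v) => t /and3P[].
Qed.

(** The hub pairs make every large bipartition costly for both signs: a
    four-cycle on a separated pair has crossing edges in positions of both parities. *)
Lemma separated_deficit (X : {set G}) b (x : {set G} -> option bool) :
  (forall e, e \in boundary X -> x e != Some b) ->
  count (separates X) (map fst R2) <= deficit (map x edge_order).
Proof.
move=> xX; rewrite /edge_order map_cat; apply: leq_trans (deficit_cat _ _).
apply: leq_trans (leq_addr _ _).
rewrite /packing_edges map_flatten -map_comp; apply: leq_trans (deficit_flatten _ _).
rewrite count_map -sum1_count big_mkcond /= !big_seq; apply: leq_sum => q /(allP R2_quads).
case/and4P=> a1 a2 a3 a4; case: ifP => // sep.
apply: (@deficit_quad b); move: sep; rewrite /separates /= => sep.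
  have : ([set q.1.1; q.2.1] \in boundary X) || ([set q.1.2; q.2.1] \in boundary X).
    by rewrite !in_boundary //; move: sep; case: (_ \in X); case: (_ \in X); case: (_ \in X).
  by case/orP=> /xX ->; rewrite ?orbT.
have : ([set q.1.1; q.2.2] \in boundary X) || ([set q.1.2; q.2.2] \in boundary X).
  by rewrite !in_boundary //; move: sep; case: (_ \in X); case: (_ \in X); case: (_ \in X).
by case/orP=> /xX ->; rewrite ?orbT.
Qed.

Section Estimate.
Variables (X X' : {set G}) (x : {set G} -> option bool).
Hypothesis xX : forall e, e \in boundary X -> x e != Some true.
Hypothesis xX' : forall e, e \in boundary X' -> x e != Some false.

Let Z := X :|: X'.
Let S z := (z \in X) != (z \in X').
Let O u := u \notin Z.
Let F e := (e \in boundary X) && (e \in boundary X').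

Lemma estimate_SO z : S z -> ~~ O z.
Proof. by rewrite /S /O negbK inE; case: (z \in X); case: (z \in X'). Qed.

Lemma estimate_sign z u : S z -> O u -> adj z u -> x [set z; u] != Some (z \in X).
Proof.
rewrite /S /O inE negb_or => Sz /andP[uX uX'] zu; move: Sz.
case: (boolP (z \in X)) => zX; case: (boolP (z \in X')) => zX' // _.
  by apply: xX; rewrite in_boundary // zX (negbTE uX).
by apply: xX'; rewrite in_boundary // zX' (negbTE uX').
Qed.

Lemma estimate_zero e : F e -> x e = None.
Proof. by case/andP=> /xX + /xX'; case: (x e) => [[]|]. Qed.

Lemma estimate_SOF z u : S z -> O u -> ~~ F [set z; u].
Proof.
rewrite /S /O /F inE negb_or => Sz /andP[uX uX']; apply/negP => /andP[].
move=> b b'; have zu : adj z u by rewrite -edge_adj (subsetP (boundary_edges _) _ b).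
move: b b' Sz; rewrite !in_boundary // (negbTE uX) (negbTE uX').
by case: (_ \in X); case: (_ \in X').
Qed.

Lemma estimate_OOF u v : O u -> O v -> ~~ F [set u; v].
Proof.
rewrite /O /F !in_setU !negb_or => /andP[uX _] /andP[vX _]; apply/negP => /andP[b _].
have uv : adj u v by rewrite -edge_adj (subsetP (boundary_edges _) _ b).
by move: b; rewrite in_boundary // (negbTE uX) (negbTE vX).
Qed.

(** The base point is in positions 0, 4 and 8 of a double square. *)
Definition clean (t : G * seq G) := all O (take 3 t.2 ++ take 3 (drop 4 t.2)).
Definition clean_quad (q : quad G) := [&& O q.2.1, O q.1.2 & O q.2.2].

Lemma double_squaresP (R : seq (quad G)) t : ~~ odd (size R) -> t \in double_squares R ->
  exists v a w b c y d, t = double_square v a w b c y d.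
Proof.
move: R; apply: (@ind2 _ (fun R => t \in double_squares R -> _)) => // q1 q2 R IH.
rewrite inE => /predU1P[->|/IH //]; rewrite /double_square.
by do 7 eexists.
Qed.

Lemma deficit_squares t : t \in squares ->
  clean_visits O S t.1 t.2 + count F (trail_edges t) + 2 * (S t.1 && clean t) <=
  deficit (map x (trail_edges t)).
Proof.
move=> ts; have wt : path adj t.1 t.2 by exact: (allP squares_walk).
case: (boolP (S t.1 && clean t)) => [/andP[]|_]; last first.
  rewrite muln0 addn0; apply: (deficit_trail (sgn := fun z => z \in X)) wt.
  - exact: estimate_SO.
  - exact: estimate_sign.
  - exact: estimate_zero.
  - exact: estimate_SOF.
case/flatten_mapP: ts => v _ /(double_squaresP (even_based v)).
move=> [v' [a [w [b [c [y [d Et]]]]]]]; rewrite Et in wt *.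
rewrite /clean /= => Sv al.
apply: (deficit_double_square (sgn := fun z => z \in X)) wt Sv _ => //.
- exact: estimate_SO.
- exact: estimate_sign.
- exact: estimate_SOF.
- exact: estimate_OOF.
Qed.

Lemma deficit_edge_order :
  count F edge_order + \sum_(t <- squares ++ D) clean_visits O S t.1 t.2 +
    2 * count (fun t => S t.1 && clean t) squares <= deficit (map x edge_order).
Proof.
rewrite /edge_order !map_cat !count_cat big_cat /=.
have h2 : count F (packing_edges R2) <= deficit (map x (packing_edges R2)).
  by apply: deficit_count_zero; exact: estimate_zero.
have h1 : count F (trails_edges squares) + \sum_(t <- squares) clean_visits O S t.1 t.2 +
    2 * count (fun t => S t.1 && clean t) squares <=
    deficit (map x (trails_edges squares)).
  rewrite /trails_edges map_flatten -map_comp; apply: leq_trans (deficit_flatten _ _).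
  rewrite count_flatten sumnE !big_map -sum1_count [in X in _ + X]big_mkcond big_distrr /=.
  rewrite -!big_split /= !big_seq; apply: leq_sum => t /deficit_squares; apply: leq_trans.
  by rewrite [_ + clean_visits _ _ _ _]addnC leq_add2l; case: (_ && _).
have h0 : count F (trails_edges D) + \sum_(t <- D) clean_visits O S t.1 t.2 <=
    deficit (map x (trails_edges D)).
  rewrite /trails_edges map_flatten -map_comp; apply: leq_trans (deficit_flatten _ _).
  rewrite count_flatten sumnE !big_map.
  rewrite -!big_split /= !big_seq; apply: leq_sum => t /(allP D_walks) wt.
  rewrite addnC; apply: (deficit_trail (sgn := fun z => z \in X)) wt.
  - exact: estimate_SO.
  - exact: estimate_sign.
  - exact: estimate_zero.
  - exact: estimate_SOF.
have arith f2 f1 f0 v1 v0 g d2 d1 d0 d10 d : f2 <= d2 -> f1 + v1 + 2 * g <= d1 ->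
    f0 + v0 <= d0 -> d1 + d0 <= d10 -> d2 + d10 <= d ->
    f2 + (f1 + f0) + (v1 + v0) + 2 * g <= d by clear; lia.
exact: (arith _ _ _ _ _ _ _ _ _ _ _ h2 h1 h0 (deficit_cat _ _) (deficit_cat _ _)).
Qed.

Lemma count_edge_order (P : pred {set G}) :
  count P edge_order = #|[set e in edges G | P e]|.
Proof.
rewrite (permP perm_edge_order) -sum1_count big_enum_cond /= sum1_card.
by apply: eq_card => e; rewrite [RHS]inE.
Qed.

Lemma bad_edge_order z : count (bad O z) edge_order <= #|Z|.
Proof.
rewrite count_edge_order; apply: leq_trans (leq_imset_card (fun u => [set z; u]) Z).
apply: subset_leq_card; apply/subsetP => e; rewrite inE => /andP[/edgesP[u [v [uv ->]]]].
rewrite bad_edge ?adj_neq // !negbK => /orP[]/andP[/eqP<- h2].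
  by apply/imsetP; exists v.
by apply/imsetP; exists u; rewrite // setUC.
Qed.

Lemma bad_trails z :
  count (bad O z) (trails_edges squares) + count (bad O z) (trails_edges D) <= #|Z|.
Proof.
apply: leq_trans (bad_edge_order z); rewrite /edge_order !count_cat; exact: leq_addl.
Qed.

Lemma size_double_squares (R : seq (quad G)) : ~~ odd (size R) ->
  2 * size (double_squares R) = size R.
Proof. by move: R; apply: ind2 => //= q1 q2 R IH; rewrite mulnS IH. Qed.

Lemma count_squares (P : pred (G * seq G)) :
  count P squares = \sum_v count P (double_squares (based v)).
Proof. by rewrite count_flatten sumnE big_map big_map big_enum. Qed.

Lemma count_squares_at (f : G * seq G -> G) z :
  (forall v t, t \in double_squares (based v) -> f t = v) ->
  count (fun t => f t == z) squares = h.
Proof.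
move=> fv; rewrite count_squares (bigD1 z) //= [X in _ + X]big1 => [|v nv].
  rewrite addn0 (eq_in_count (a2 := predT)) => [|t /fv ->]; last by rewrite eqxx.
  rewrite count_predT; apply/eqP; rewrite -(eqn_pmul2l (isT : 0 < 2)).
  by rewrite size_double_squares ?even_based ?size_based.
rewrite (eq_in_count (a2 := pred0)) ?count_pred0 // => t /fv ->.
by rewrite (negbTE nv).
Qed.

Lemma squares_ends z : \sum_(t <- squares) ((t.1 == z) + (last t.1 t.2 == z)) = 2 * h.
Proof.
rewrite big_split /= mul2n -addnn; congr (_ + _).
  rewrite -[RHS](@count_squares_at fst z) ?sum1_count -?sum1_count ?[RHS]big_mkcond //.
  by move=> v t /(allP (squares_based v)) /and3P[_ /eqP].
rewrite -[RHS](@count_squares_at (fun t => last t.1 t.2) z) -?sum1_count ?[RHS]big_mkcond //.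
by move=> v t /(allP (squares_based v)) /and3P[_ _ /eqP].
Qed.

Definition gain z := count clean (double_squares (based z)).

Lemma sum_gain : count (fun t => S t.1 && clean t) squares = \sum_(z | S z) gain z.
Proof.
rewrite count_squares [RHS]big_mkcond; apply: eq_bigr => v _.
case: (boolP (S v)) => Sv.
  by apply: eq_in_count => t /(allP (squares_based v)) /and3P[_ /eqP-> _]; rewrite Sv.
rewrite (eq_in_count (a2 := pred0)) ?count_pred0 // => t.
by move=> /(allP (squares_based v)) /and3P[_ /eqP-> _]; rewrite (negbTE Sv).
Qed.

Lemma count_double_squares_clean (R : seq (quad G)) : ~~ odd (size R) ->
  size R <= 2 * (count clean (double_squares R) + count (predC clean_quad) R).
Proof.
move: R; apply: ind2 => // q1 q2 R IH.
have -> : size [:: q1, q2 & R] = 2 + size R by [].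
have -> : count clean (double_squares [:: q1, q2 & R]) =
   clean_quad q1 && clean_quad q2 + count clean (double_squares R).
  rewrite /= /clean /= /clean_quad; congr (nat_of_bool _ + _).
  by case: (O _); case: (O _); case: (O _); rewrite //= andbT.
rewrite /=; case: (clean_quad q1); case: (clean_quad q2); rewrite /= ?add0n; lia.
Qed.

(** A vertex of [Z] spoils at most two of the four-cycles based at [z], as the partner of
    [z] in one of them and as the end of an edge at [z] in another one. *)
Lemma card_unclean z : count (predC clean_quad) (based z) <= 2 * #|Z|.
Proof.
have c1 : count (fun q : quad G => ~~ O q.1.2) (based z) <= #|Z|.
  have u : uniq [seq q.1.2 | q : quad G <- based z].
    have : uniq (map fst (based z)).
      apply: (@subseq_uniq _ _ (map fst R1)); last by rewrite R1_base uniq_cyclic_pairs.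
      by apply: map_subseq; apply: filter_subseq.
    have -> : map fst (based z) = map (pair z) [seq q.1.2 | q : quad G <- based z].
      rewrite -map_comp; apply/eq_in_map => q; rewrite mem_filter => /andP[/eqP<- _] /=.
      by case: q.1.
    exact: map_uniq.
  rewrite (_ : count _ _ = count (mem Z) [seq q.1.2 | q : quad G <- based z]).
    rewrite -size_filter cardE; apply: uniq_leq_size; first exact: filter_uniq.
    by move=> y; rewrite mem_filter mem_enum => /andP[].
  by rewrite count_map; apply: eq_count => q /=; rewrite negbK.
have c2 : count (fun q : quad G => ~~ (O q.2.1 && O q.2.2)) (based z) <= #|Z|.
  apply: leq_trans (leq_trans (leq_addr _ _) (bad_trails z)).
  rewrite (permP perm_squares) /based; elim: (R1) R1_quads => [|q R IH] //=.
  case/andP=> /and4P[a1 a2 a3 a4] qR; rewrite /packing_edges /= -/(packing_edges R).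
  case: eqP => [E|_] /=; last by apply: leq_trans (IH qR) _; rewrite !addnA leq_addl.
  rewrite !addnA; apply: leq_add (IH qR); rewrite -!addnA.
  rewrite !bad_edge ?adj_neq // -?E ?eqxx //=.
  rewrite addnA; apply: leq_trans (leq_addr _ _).
  by case: (O q.2.1); case: (O q.2.2) => //=; case: (_ && _).
rewrite mul2n -addnn; apply: leq_trans (leq_add c1 c2).
rewrite -count_predUI; apply: leq_trans (leq_addr _ _); apply: sub_count => q /=.
by rewrite /clean_quad; case: (O _); case: (O _); case: (O _).
Qed.

Lemma gain_ge z : h <= gain z + 2 * #|Z|.
Proof.
have := count_double_squares_clean (even_based z); rewrite size_based leq_pmul2l //.
by move/leq_trans; apply; rewrite leq_add2l card_unclean.
Qed.

Definition visits z := \sum_(t <- squares ++ D) clean_visits O (pred1 z) t.1 t.2.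

(** A double square based at [z] has two ends at [z], hence the loss of [2 * h]. *)
Lemma degree_edge_order z : count (fun e : {set G} => z \in e) edge_order <=
  2 * m2 + 2 * visits z + 2 * #|Z| + 2 * h + 2.
Proof.
have deg (TL : seq (G * seq G)) : all (@is_walk G) TL ->
    count (fun e : {set G} => z \in e) (trails_edges TL) <=
    2 * (\sum_(t <- TL) clean_visits O (pred1 z) t.1 t.2) +
    2 * count (bad O z) (trails_edges TL) +
    \sum_(t <- TL) ((t.1 == z) + (last t.1 t.2 == z)).
  elim: TL => [|t TL IH] /=; first by rewrite !big_nil.
  case/andP=> wt /IH {}IH; rewrite !big_cons /trails_edges /= !count_cat.
  rewrite -/(trails_edges TL); have := trail_degree O z wt.
  have arith a1 a2 b1 b2 c1 c2 d1 d2 e1 : a1 <= 2 * b1 + 2 * c1 + d1 + e1 ->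
    a2 <= 2 * b2 + 2 * c2 + d2 -> a1 + a2 <= 2 * (b1 + b2) + 2 * (c1 + c2) + (d1 + e1 + d2).
    by clear; lia.
  by move/arith; apply.
have h1 := deg _ squares_walk; have h2 := deg _ D_walks.
have hb := bad_trails z; have he := D_ends z; rewrite squares_ends in h1.
rewrite /edge_order /visits !count_cat big_cat /=.
have arith a2 a1 a0 v1 v0 b1 b0 e0 m k zz : a2 <= 2 * m -> a1 <= 2 * v1 + 2 * b1 + 2 * k ->
  a0 <= 2 * v0 + 2 * b0 + e0 -> b1 + b0 <= zz -> e0 <= 2 ->
  a2 + (a1 + a0) <= 2 * m + 2 * (v1 + v0) + 2 * zz + 2 * k + 2 by clear; lia.
exact: arith (R2_degree z) h1 h2 hb he.
Qed.

(** Every edge that crosses exactly one of the two cuts has an end in exactly one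
    of the two sets. *)
Lemma boundaries_le : #|boundary X| + #|boundary X'| <=
  2 * count F edge_order + \sum_(z | S z) count (fun e : {set G} => z \in e) edge_order.
Proof.
pose bX e := e \in boundary X; pose bX' e := e \in boundary X'.
have cb (Y : {set G}) : #|boundary Y| = count (fun e => e \in boundary Y) edge_order.
  rewrite count_edge_order; apply: eq_card => e; rewrite [RHS]inE.
  by case: (boolP (e \in boundary Y)) => [/(subsetP (boundary_edges _)) ->|_]; rewrite ?andbF.
rewrite !cb !count_sum; under [\sum_(z | S z) _]eq_bigr do rewrite count_sum.
rewrite exchange_big big_distrr -!big_split !big_seq /=.
apply: leq_sum => e; rewrite (perm_mem perm_edge_order) mem_enum => /edgesP[u [v [uv ->]]].
rewrite /F !in_boundary //.
case: (boolP (S u)) => Su.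
  have : 0 < \sum_(z | S z) (z \in [set u; v] : nat).
    by rewrite (bigD1 u) //= set21.
  by case: ((u \in X) != _); case: ((u \in X') != _).
case: (boolP (S v)) => Sv.
  have : 0 < \sum_(z | S z) (z \in [set u; v] : nat).
    by rewrite (bigD1 v) //= set22.
  by case: ((u \in X) != _); case: ((u \in X') != _).
move: Su Sv; rewrite /S !negbK => /eqP-> /eqP->.
by case: (_ != _).
Qed.

(** The edges in both boundaries are zeros. The edges at a vertex of exactly one of the
    two sets lose half of their number, one for each visit. Unclean visits, edges of hub
    four-cycles and ends of walks reduce this, but the double squares based at the vertex
    add [2 * h] and outweigh these reductions. So the deficit is at least the average size
    of the two boundaries. *)
Lemma boundaries_deficit : m2 + 5 * #|Z| + 1 <= h ->
  #|boundary X| + #|boundary X'| <= 2 * deficit (map x edge_order).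
Proof.
move=> hZ; apply: leq_trans boundaries_le _.
apply: leq_trans (_ : _ <= 2 * _) (leq_mul (leqnn 2) deficit_edge_order).
rewrite sum_gain.
have -> : \sum_(t <- squares ++ D) clean_visits O S t.1 t.2 = \sum_(z | S z) visits z.
  by rewrite exchange_big; apply: eq_bigr => t _; rewrite sum_clean_visits.
rewrite 2!mulnDr mulnA -addnA leq_add2l !big_distrr -big_split /=.
apply: leq_sum => z _; have := degree_edge_order z; have := gain_ge z.
have arith c m v zz k g : k <= g + 2 * zz -> c <= 2 * m + 2 * v + 2 * zz + 2 * k + 2 ->
  m + 5 * zz + 1 <= k -> c <= 2 * v + 2 * 2 * g by clear; lia.
by move=> h1 h2; exact: arith h1 h2 hZ.
Qed.

End Estimate.

End Ordering.

(** * Dense graphs *)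

Section Existence.
Variable G : sgraph.
Notation n := #|G|.
Hypothesis dense : 5 * n <= 6 * min_degree G.

(** Inclusion and exclusion: the neighbourhoods have at least 5/6 of the vertices each. *)
Lemma common_neighbours (v w : G) : 2 * n <= 3 * #|[set a | adj v a && adj w a]|.
Proof.
have dv (z : G) : 5 * n <= 6 * #|[set a | adj z a]|.
  by apply: leq_trans dense _; rewrite leq_pmul2l //; exact: (@bigmin_le G predT (@degree G) #|G| z isT).
have -> : [set a | adj v a && adj w a] = [set a | adj v a] :&: [set a | adj w a].
  by apply/setP => a; rewrite !inE.
have := cardsUI [set a | adj v a] [set a | adj w a].
have U : #|[set a | adj v a] :|: [set a | adj w a]| <= #|G| by apply: max_card.
have := dv v; have := dv w; move: U; clear.
set c := #|_ :&: _|; set u := #|_ :|: _|; set d := #|_|; set d' := #|[set a | adj w a]|.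
set m := #|G|; lia.
Qed.

(** Two greedy packings, the second in the graph without the edges of the first. The
    maximal load is 9 times the maximal number of pairs at a vertex, so that at most an
    eighth of the vertices can reach it. *)
Lemma pieces_exist q l h (p := 2 * (q * l) + n %/ q + 1) :
  0 < q -> q * l <= n -> 0 < h -> 2 * h < n -> n <= 9 * (n %/ 8) ->
  3 * (n %/ 8 + 40 * p + 160 * h + 2) <= 2 * n ->
  exists R2 R1 D, [/\ all (is_quad (@adj G)) R2 /\ map fst R2 = hub_pairs G q l,
    all (is_quad (@adj G)) R1 /\ map fst R1 = cyclic_pairs G (2 * h),
    (forall z, count (fun d : {set G} => z \in d) (packing_edges R2) <= 2 * (10 * p)),
    all (@is_walk G) D /\
      (forall z, \sum_(t <- D) ((t.1 == z) + (last t.1 t.2 == z)) <= 2) &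
    perm_eq (packing_edges R2 ++ packing_edges R1 ++ trails_edges D) (enum (edges G))].
Proof.
move=> q0 ql h0 hn n8 room; have p0 : 0 < p by rewrite /p addn1.
have size_le Q k : (forall z : G, load z Q <= k) -> 2 * size Q <= n * k.
  by move=> lQ; rewrite -sum_load -sum_nat_const; apply: leq_sum => z _; apply: lQ.
have [||||v w _|R2 [b2 q2 u2 l2]] := @greedy_packing _ _ (@adj_irrefl G)
    (hub_pairs G q l) p (9 * p) (n %/ 8).
- exact: hub_pairs_neq.
- by move=> z; apply: load_hub_pairs.
- by rewrite muln_gt0.
- apply: leq_trans (size_le _ _ (fun z => load_hub_pairs q0 ql z)) _.
  by rewrite -/p -mulnA mulnCA mulnC leq_pmul2l.
- have := common_neighbours v w; move: room; clear; lia.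
have d2 z : count (fun d : {set G} => z \in d) (packing_edges R2) <= 2 * (10 * p).
  apply: leq_trans (degree_packing _ _) _; rewrite b2.
  have := load_hub_pairs q0 ql z; have := l2 z; rewrite -/p; clear; lia.
pose e' : rel G := fun v a => adj v a && ([set v; a] \notin packing_edges R2).
have irr : irreflexive e' by move=> v; rewrite /e' adj_irrefl.
have [||||v w _|R1 [b1 q1 u1 l1]] := @greedy_packing _ _ irr
    (cyclic_pairs G (2 * h)) (4 * h) (36 * h) (n %/ 8).
- by apply: cyclic_pairs_neq.
- by move=> z; apply: leq_trans (load_cyclic_pairs _ _) _; clear; lia.
- by rewrite muln_gt0.
- by rewrite size_cyclic_pairs; move: n8; clear; nia.
- pose used z := [set a | [set z; a] \in packing_edges R2].
  have used_le z : #|used z| <= 20 * p.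
    by apply: leq_trans (card_used _ _) _; apply: leq_trans (d2 z) _; rewrite mulnA.
  have sub : [set a | adj v a && adj w a] \subset
      [set a | e' v a && e' w a] :|: (used v :|: used w).
    apply/subsetP => a; rewrite !inE /e' => /andP[-> ->] /=.
    by case: (_ \in packing_edges R2); case: (_ \in packing_edges R2).
  have c1 := subset_leq_card sub.
  have c2 := (leq_card_setU [set a | e' v a && e' w a] (used v :|: used w)).1.
  have c3 := (leq_card_setU (used v) (used w)).1.
  have := common_neighbours v w; have := used_le v; have := used_le w.
  move: c1 c2 c3 room; clear.
  set A := #|[set a | adj v a && adj w a]|; set B := #|_|; set C := #|[set a | e' v a && _]|.
  set U := #|used v :|: used w|; set Uv := #|used v|; set Uw := #|used w|.
  by set m := #|G|; lia.
have q1' : all (is_quad (@adj G)) R1.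
  by apply: sub_all q1 => q' /and4P[/andP[a1 _] /andP[a2 _] /andP[a3 _] /andP[a4 _]]; apply/and4P.
have in_edges (R : seq (quad G)) : all (is_quad (@adj G)) R -> {subset packing_edges R <= edges G}.
  move=> /allP qR d /flatten_mapP[q' /qR /and4P[a1 a2 a3 a4]].
  by rewrite !in_cons in_nil orbF => /or4P[] /eqP->; rewrite edge_adj.
have disj : ~~ has (mem (packing_edges R2)) (packing_edges R1).
  apply/hasPn => d /flatten_mapP[q' /(allP q1)].
  case/and4P=> /andP[_ n1] /andP[_ n2] /andP[_ n3] /andP[_ n4].
  by rewrite !in_cons in_nil orbF => /or4P[] /eqP->.
pose E := [seq d <- enum (edges G) | d \notin packing_edges R2 ++ packing_edges R1].
have [|D [wD pD eD]] := @trail_decomposition G E.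
  by move=> d; rewrite mem_filter mem_enum => /andP[].
exists R2, R1, D; split=> //.
have p' : perm_eq (packing_edges R2 ++ packing_edges R1 ++ trails_edges D)
   ((packing_edges R2 ++ packing_edges R1) ++ E) by rewrite catA perm_cat2l.
apply: perm_trans p' _; apply: uniq_perm; last first.
- move=> d; rewrite mem_cat mem_filter mem_enum.
  case: (boolP (d \in _ ++ _)) => //=; rewrite mem_cat.
  by case/orP=> /in_edges ->.
- exact: enum_uniq.
rewrite cat_uniq filter_uniq ?enum_uniq // cat_uniq u2 u1 disj /= andbT.
by apply/hasPn => d; rewrite mem_filter => /andP[].
Qed.

End Existence.

Section Combinatorial.
Variables (G : sgraph) (r : nat).
Notation n := #|G|.

Lemma boundary_setC (X : {set G}) : boundary (~: X) = boundary X.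
Proof.
apply/setP => e; apply/idP/idP => b; have := subsetP (boundary_edges _) _ b;
  move=> /edgesP[u [v [uv E]]]; move: b; rewrite E !in_boundary // !inE;
  by case: (_ \in X); case: (_ \in X).
Qed.

Lemma cut_number_small : 2 * r.+1 <= n -> cut_number G r.+1 <= r.+1 * n.
Proof.
move=> rn; pose X := [set x in take r.+1 (enum G)].
have cX : #|X| = r.+1.
  rewrite cardsE (card_uniqP _) ?take_uniq ?enum_uniq // size_takel // -cardE.
  by apply: leq_trans rn; lia.
have cC : r.+1 <= #|~: X| by have := cardsC X; move: rn; rewrite cX; lia.
apply: leq_trans (_ : cut_size X <= _).
  apply: cut_number_le; rewrite /is_scut /is_cut -!card_gt0 cX leq_min leqnn cC /= andbT.
  exact: leq_trans cC.
rewrite -cX -cardsT -cardsX.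
apply: leq_trans (leq_imset_card (fun p => [set p.1; p.2]) _).
apply: subset_leq_card; apply/subsetP => e; rewrite inE => /andP[_ /exists_inP[u uX /exists_inP[v _ /eqP->]]].
by apply/imsetP; exists (u, v); rewrite // in_setX uX in_setT.
Qed.

(** By the hub pairs, a bipartition with two parts of size at least [l] costs too much, so
    one of the two sides is small; both have the same boundary. *)
Lemma small_side q l (R2 R1 : seq (quad G)) D (x : {set G} -> option bool) b (X : {set G}) :
  0 < q -> q * l <= n -> all (is_quad (@adj G)) R2 -> map fst R2 = hub_pairs G q l ->
  4 * deficit (map x (edge_order R2 R1 D)) < l * l ->
  two_sided (fun y z => [set y; z] \in [set d in edges G | x d == Some b]) X ->
  r < #|X| -> r < #|~: X| ->
  exists Y : {set G}, [/\ #|Y| < l, cut_number G r.+1 <= #|boundary Y| &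
    forall e, e \in boundary Y -> x e != Some b].
Proof.
move=> q0 ql qR2 bR2 def ts rX rC.
have avoid e : e \in boundary X -> x e != Some b.
  move=> eX; have /edgesP[u [v [uv E]]] := subsetP (boundary_edges _) _ eX.
  move: eX; rewrite E in_boundary //; apply: contraNN => xe; apply/eqP.
  by apply: (two_sidedP _ _ ts); rewrite inE edge_adj uv.
have large (Y : {set G}) : r < #|Y| -> r < #|~: Y| -> cut_number G r.+1 <= #|boundary Y|.
  move=> rY rCY; apply: (@cut_number_le G r.+1 Y).
  rewrite /is_scut /is_cut -!card_gt0 leq_min rY rCY !andbT.
  by rewrite (leq_trans _ rY) // (leq_trans _ rCY).
case: (ltnP #|X| l) => lX; first by exists X; split=> //; apply: large.
case: (ltnP #|~: X| l) => lC.
  exists (~: X); split=> //; first by apply: large; rewrite ?setCK.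
  by move=> e; rewrite boundary_setC; apply: avoid.
have := separated_hub_pairs q0 ql lX lC; rewrite -bR2 => sep.
move: def; rewrite ltnNge (leq_trans sep) // leq_pmul2l //.
exact: separated_deficit R1 D qR2 _ _ _ avoid.
Qed.

(** If neither sign had a large component, there would be a small set for each sign whose
    boundary avoids that sign. Both boundaries have at least [cut_number G r.+1] edges,
    and the deficit is smaller than this number. *)
Lemma long_word_giant q l h (p := 2 * (q * l) + n %/ q + 1) (R2 R1 : seq (quad G)) D :
  0 < q -> q * l <= n -> 2 * h <= n -> 3 * r < n ->
  all (is_quad (@adj G)) R2 -> map fst R2 = hub_pairs G q l ->
  all (is_quad (@adj G)) R1 -> map fst R1 = cyclic_pairs G (2 * h) ->
  (forall z, count (fun d : {set G} => z \in d) (packing_edges R2) <= 2 * (10 * p)) ->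
  all (@is_walk G) D ->
  (forall z, \sum_(t <- D) ((t.1 == z) + (last t.1 t.2 == z)) <= 2) ->
  perm_eq (packing_edges R2 ++ packing_edges R1 ++ trails_edges D) (enum (edges G)) ->
  10 * p + 5 * (2 * l) + 1 <= h -> 4 * cut_number G r.+1 <= l * l ->
  forall x : {set G} -> option bool,
     #|edges G| - cut_number G r.+1 < alt (map x (edge_order R2 R1 D)) ->
     exists b v, n - r <= #|[set w | connect
        (fun y z => [set y; z] \in [set d in edges G | x d == Some b]) v w]|.
Proof.
move=> q0 ql hn rn qR2 bR2 qR1 bR1 d2 wD eD pD hh ll x long.
set L := edge_order R2 R1 D in long.
have pL : perm_eq L (enum (edges G)) by exact: perm_edge_order bR1 pD.
have def : deficit (map x L) < cut_number G r.+1.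
  have arith d a m c : d + a = m -> m - c < a -> c <= m -> d < c by clear; lia.
  apply: arith (deficitE _) _ _; rewrite size_map (perm_size pL) -cardE //.
  exact: cut_number_le_edges.
have def4 : 4 * deficit (map x L) < l * l by apply: leq_trans ll; rewrite ltn_pmul2l.
pose rel_of b : rel G := fun y z => [set y; z] \in [set d in edges G | x d == Some b].
have rel_sym b : symmetric (rel_of b) by move=> y z; rewrite /rel_of setUC.
case: (giant_or_balanced (rel_sym true) rn) => [[v hv]|[X [tX rX cX]]].
  by exists true, v.
case: (giant_or_balanced (rel_sym false) rn) => [[v hv]|[X' [tX' rX' cX']]].
  by exists false, v.
have [Y [lY cY aY]] := small_side q0 ql qR2 bR2 def4 tX rX cX.
have [Y' [lY' cY' aY']] := small_side q0 ql qR2 bR2 def4 tX' rX' cX'.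
have Z : #|Y :|: Y'| <= 2 * l.
  apply: leq_trans (leq_card_setU _ _) _.
  by rewrite mul2n -addnn leq_add // ltnW.
have hZ : 10 * p + 5 * #|Y :|: Y'| + 1 <= h.
  by apply: leq_trans hh; rewrite leq_add2r leq_add2l leq_pmul2l.
have := boundaries_deficit qR2 qR1 bR1 hn d2 wD eD pD aY aY' hZ.
move=> le; have := leq_trans (leq_add cY cY') le.
by rewrite -/L addnn -mul2n leq_pmul2l // leqNgt def.
Qed.

End Combinatorial.

(** The hub pairs may only use up a small part of the gain [h = n %/ 400] at each base
    point; as their number at a vertex is of order [n %/ q], a large constant [q] will do.
    With [l] of order [n %/ q ^ 2], the bound on [s] makes [s * n], which bounds the cut
    number, small against the number [l * l] of separated hub pairs. *)
Lemma parameters (q n s : nat) : q = 200 * 100 -> 16 * (q * q * (q * q)) * s <= n -> 0 < s ->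
  exists l h, let p := 2 * (q * l) + n %/ q + 1 in
  [/\ q * l <= n, 0 < h /\ 2 * h < n, n <= 9 * (n %/ 8),
      3 * (n %/ 8 + 40 * p + 160 * h + 2) <= 2 * n &
      10 * p + 5 * (2 * l) + 1 <= h /\ 4 * (s * n) <= l * l].
Proof.
move=> qE hn s0; exists (n %/ (q * q)), (n %/ 400) => p.
have q0 : 0 < q by rewrite qE.
have qq0 : 0 < q * q by rewrite muln_gt0 q0.
set l := n %/ (q * q) in p *; set A := n %/ q in p *.
have lA : q * l <= A by rewrite leq_divRL // mulnAC mulnC leq_trunc_div.
have Aq : A * q <= n by exact: leq_trunc_div.
have nl : n < (l + 1) * (q * q) by rewrite addn1 ltn_ceil.
have qqn : 16 * (q * q * (q * q)) <= n by apply: leq_trans hn; rewrite leq_pmulr.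
have qn : 16 * (q * q) <= n by apply: leq_trans qqn; rewrite leq_pmul2l // leq_pmulr.
have q1n : 16 * q * 20 <= n.
  by apply: leq_trans qn; rewrite -mulnA leq_pmul2l // leq_pmul2l // qE.
have h1 : n %/ 400 * 400 <= n by exact: leq_trunc_div.
have h2 : n < (n %/ 400 + 1) * 400 by rewrite addn1 ltn_ceil.
have e1 : n %/ 8 * 8 <= n by exact: leq_trunc_div.
have e2 : n < (n %/ 8 + 1) * 8 by rewrite addn1 ltn_ceil.
have lA' : l <= A by apply: leq_trans lA; rewrite leq_pmull.
have l0 : 0 < l by rewrite divn_gt0 //; apply: leq_trans qn; rewrite leq_pmull.
have last_part : 4 * (s * n) <= l * l.
  have n2 : n <= 2 * l * (q * q).
    apply: leq_trans (ltnW nl) _; rewrite leq_pmul2r //; lia.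
  rewrite -(@leq_pmul2l (4 * (q * q * (q * q)))) ?muln_gt0 ?q0 //.
  apply: (@leq_trans (n * n)).
    have -> : 4 * (q * q * (q * q)) * (4 * (s * n)) = 16 * (q * q * (q * q)) * s * n by ring.
    by rewrite leq_mul2r hn orbT.
  apply: leq_trans (leq_mul n2 n2) _; apply: eq_leq; ring.
have pA : p <= 3 * A + 1 by rewrite /p; lia.
have hp : 200 * 100 * A <= n by rewrite -qE mulnC.
rewrite qE in q1n.
move: (n %/ 400) (n %/ 8) h1 h2 e1 e2 => h e h1 h2 e1 e2.
have ql : q * l <= n by rewrite (leq_trans lA) // (leq_trans _ Aq) // leq_pmulr.
move: {nl Aq qqn qn hn} (p) pA lA' l0 => p' pA lA' l0.
split=> //; lia.
Qed.

Theorem dense_tree_graph : exists K, forall (G : sgraph) r,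
  K * r.+1 <= #|G| -> 5 * #|G| <= 6 * min_degree G ->
  chromatic_number (tree_graph G (#|G| - r)) = cut_number G r.+1.
Proof.
have [q qE] : exists q, q = 200 * 100 by eexists.
exists (16 * (q * q * (q * q))) => G r hn dense.
have [l [h [ql [h0 hn2] n8 room [hh ll]]]] := parameters qE hn (ltn0Sn r).
have q0 : 0 < q by rewrite qE.
have rn : 16 * r.+1 <= #|G|.
  by apply: leq_trans hn; rewrite leq_pmul2r // leq_pmulr // !muln_gt0 q0.
apply/eqP; rewrite eqn_leq chromatic_le_cut_number ?(leq_trans _ rn) //=; last by lia.
have [R2 [R1 [D [[qR2 bR2] [qR1 bR1] d2 [wD eD] pD]]]] := pieces_exist dense q0 ql h0 hn2 n8 room.
apply: (@cut_number_le_chromatic G r (edge_order R2 R1 D)).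
- by apply: leq_trans rn; lia.
- exact: perm_edge_order bR1 pD.
apply: (long_word_giant q0 ql (ltnW hn2) _ qR2 bR2 qR1 bR1 d2 wD eD pD hh).
  by apply: leq_trans rn; lia.
apply: leq_trans ll; rewrite leq_pmul2l //; apply: cut_number_small.
by apply: leq_trans rn; lia.
Qed.

(** * The asymptotic statement *)

(* Imported here because these files hide names of finite set theory used above. *)
From mathcomp Require Import all_order all_algebra.
From mathcomp Require Import classical_sets reals topology normedtype sequences.
From mathcomp Require Import lra.
Import Order.TTheory GRing.Theory Num.Theory.
Import numFieldNormedType.Exports.
Local Open Scope classical_set_scope.
Local Open Scope ring_scope.

Lemma littleo_bound (R : realType) (r : nat -> nat) (K : nat) :
  (fun n : nat => (r n)%:R / n%:R : R) @ \oo --> (0 : R) ->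
  exists N : nat, forall n, (N <= n)%N -> (K * (r n).+1 <= n)%N.
Proof.
move=> r0; pose e : R := (2 * K.+1)%:R^-1.
have e0 : 0 < e by rewrite invr_gt0 ltr0n.
have [N _ hN] := cvgr0_norm_lt _ r0 e e0.
exists (maxn N (2 * K.+1)) => n; rewrite geq_max => /andP[/hN /= + Kn].
have n0 : (0 < n)%N by exact: leq_trans Kn.
rewrite ger0_norm ?divr_ge0 // ltr_pdivrMr ?ltr0n // /e mulrC ltr_pdivlMr ?ltr0n //.
rewrite -natrM ltr_nat => h; lia.
Qed.

Theorem theorem1 (R : realType) (delta : R) (r : nat -> nat)
    (delta_gt : 5%:R / 6%:R < delta) (delta_lt : delta < 1)
    (r_littleo : (fun n : nat => (r n)%:R / n%:R : R) @ \oo --> (0 : R)) :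
  exists N : nat, forall n : nat, (N <= n)%N ->
    forall G : sgraph, #|G| = n ->
      delta * n%:R <= (min_degree G)%:R ->
      chromatic_number (tree_graph G (n - r n)) = cut_number G (r n).+1.
Proof.
have [K thm] := dense_tree_graph.
have [N hN] := littleo_bound K r_littleo.
exists N => n /hN hn G nG deg; rewrite -nG in hn deg *; apply: thm => //.
rewrite -(ler_nat R) !natrM; move: deg delta_gt.
have : 0 <= #|G|%:R :> R by [].
nra.
Qed.
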